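(* Suppose that $\varepsilon>0$, $K$ and $L$ are origin-symmetric star bodies in $\mathbb{R}^n$, and $K$ is an intersection body. If for every $\xi\in S^{n-1}$ $$|K\cap \xi^\perp| \le |L\cap \xi^\perp| + \varepsilon,$$ then $$|K|^{\frac{n-1}{n}} \le |L|^{\frac{n-1}{n}} + c_n\,\varepsilon,$$ where $c_n = |B_2^n|^{\frac{n-1}{n}}/|B_2^{n-1}|$.
   Context: $|\cdot|$ denotes volume (Lebesgue measure) of the appropriate dimension; $B_2^n$ is the unit Euclidean ball in $\mathbb{R}^n$; $S^{n-1}$ is the unit Euclidean sphere; for $\xi\in S^{n-1}$, $\xi^\perp$ is the central hyperplane perpendicular to $\xi$. A closed bounded set $K\subset\mathbb{R}^n$ is a star body if every straight line passing through the origin crosses the boundary of $K$ at exactly two points different from the origin, the origin is an interior point of $K$, and the Minkowski functional $\|x\|_K=\min\{a\ge 0: x\in aK\}$ is continuous on $\mathbb{R}^n$. Its radial function is $\rho_K(x)=\|x\|_K^{-1}$. For origin-symmetric star bodies $K,L$ in $\mathbb{R}^n$, $K$ is called the intersection body of $L$ if $\rho_K(\xi)=|L\cap\xi^\perp|$ for every $\xi\in S^{n-1}$. The class of intersection bodies is the closure (within origin-symmetric star bodies) of the class of intersection bodies of star bodies in the radial metric $\rho(K,L)=\max_{\xi\in S^{n-1}}|\rho_K(\xi)-\rho_L(\xi)|$. *)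

(* Defs.v *)
From HB Require Import structures.
From mathcomp Require Import all_boot all_order all_algebra.
From mathcomp Require Import ring.
From mathcomp Require Import all_classical all_reals all_analysis.
Set Implicit Arguments.
Unset Strict Implicit.
Unset Printing Implicit Defensive.
Import Order.TTheory GRing.Theory Num.Theory.
Import numFieldNormedType.Exports.
Local Open Scope classical_set_scope.
Local Open Scope card_scope.
Local Open Scope ring_scope.

(* The canonical instance for m1 \x m2 is shadowed by the one for
   subprobabilities. *)
Lemma product_measure_sigma_finite d1 d2 (T1 : measurableType d1)
    (T2 : measurableType d2) (R : realType)
    (m1 : {sigma_finite_measure set T1 -> \bar R})
    (m2 : {sigma_finite_measure set T2 -> \bar R}) :
  sigma_finite [set: T1 * T2] (m1 \x m2)%E.
Proof.
have /sigma_finiteP[F [TF ndF Foo]] := sigma_finiteT m1.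
have /sigma_finiteP[G [TG ndG Goo]] := sigma_finiteT m2.
exists (fun n => F n `*` G n).
  rewrite -setXTT TF TG predeqE => -[x y]; split.
    move=> [/= [n _ Fnx] [k _ Gky]]; exists (maxn n k) => //; split.
    - by move: x Fnx; exact/subsetPset/ndF/leq_maxl.
    - by move: y Gky; exact/subsetPset/ndG/leq_maxr.
  by move=> [n _ []/= ? ?]; split; exists n.
move=> k; have [? ?] := Foo k; have [? ?] := Goo k.
split; first exact: measurableX.
by rewrite product_measure1E// lte_mul_pinfty// ge0_fin_numE.
Qed.

(* The n-fold power of a sigma-finite measure, on the n-tuples with the
   sigma-algebra generated by the coordinates. *)
Section cons_measure.
Context d (T : measurableType d) (R : realType) (n : nat).
Context (m : {sigma_finite_measure set T -> \bar R}).
Context (mu : {sigma_finite_measure set (n.-tuple T) -> \bar R}).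

Definition tcons (p : T * n.-tuple T) : n.+1.-tuple T :=
  [the n.+1.-tuple T of p.1 :: p.2].

Lemma measurable_tcons : measurable_fun [set: T * n.-tuple T] tcons.
Proof. exact: (measurable_cons measurable_fst measurable_snd). Qed.

HB.instance Definition _ := @isMeasurableFun.Build _ _ _ _ tcons measurable_tcons.

Definition cons_measure : set (n.+1.-tuple T) -> \bar R :=
  pushforward (m \x mu)%E tcons.

Let cons_measure0 : cons_measure set0 = 0%E.
Proof. exact: measure0. Qed.

Let cons_measure_ge0 A : (0 <= cons_measure A)%E.
Proof. exact: measure_ge0. Qed.

Let cons_measure_sigma_additive : semi_sigma_additive cons_measure.
Proof. exact: measure_semi_sigma_additive. Qed.

HB.instance Definition _ := isMeasure.Build _ _ _ cons_measure
  cons_measure0 cons_measure_ge0 cons_measure_sigma_additive.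

Let cons_measure_sigma_finite : sigma_finite [set: n.+1.-tuple T] cons_measure.
Proof.
have [F FT mF] := product_measure_sigma_finite m mu.
pose g (t : n.+1.-tuple T) : T * n.-tuple T := (thead t, [tuple of behead t]).
have mg : measurable_fun setT g.
  apply: measurable_fun_pair; [exact: measurable_tnth|exact: measurable_behead].
have gK p : g (tcons p) = p.
  by case: p => x t; rewrite /g /tcons; congr pair; exact/val_inj.
exists (fun k => g @^-1` F k).
  by rewrite -preimage_bigcup -FT preimage_setT.
move=> k; have [mFk Fk] := mF k; split.
  by rewrite -[X in measurable X]setTI; exact: mg.
rewrite /cons_measure /pushforward (_ : _ @^-1` _ = F k)//.
by apply/seteqP; split => p /=; rewrite gK.
Qed.

HB.instance Definition _ :=
  Measure_isSigmaFinite.Build _ _ _ cons_measure cons_measure_sigma_finite.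

End cons_measure.

Fixpoint power_measure d (T : measurableType d) (R : realType)
    (m : {sigma_finite_measure set T -> \bar R}) (n : nat) :
    {sigma_finite_measure set (n.-tuple T) -> \bar R} :=
  match n with
  | 0 => \d_([tuple] : 0.-tuple T)
  | k.+1 => cons_measure m (power_measure m k)
  end.

(* For Borel sets of 'rV[R]_n, n-dimensional Lebesgue measure; it is the unit
   point mass when n = 0. *)
Definition vol (R : realType) (n : nat) (A : set 'rV[R]_n) : \bar R :=
  power_measure (@lebesgue_measure R) n [set t | A (\row_i tnth t i)].

(* The norm carried by 'rV[R]_n is the sup norm, so the Euclidean structure is
   introduced separately; both norms have the same topology and the same
   bounded sets. *)
Definition dot (R : realType) (n : nat) (x y : 'rV[R]_n) : R :=
  \sum_i x ord0 i * y ord0 i.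

Definition enorm (R : realType) (n : nat) (x : 'rV[R]_n) : R :=
  Num.sqrt (dot x x).

Definition eball (R : realType) (n : nat) : set 'rV[R]_n :=
  [set x | enorm x <= 1].

Definition esphere (R : realType) (n : nat) : set 'rV[R]_n :=
  [set x | enorm x = 1].

Definition hyperplane (R : realType) (n : nat) (xi : 'rV[R]_n) : set 'rV[R]_n :=
  [set x | dot x xi = 0].

(* The rows of U form an orthonormal basis of hyperplane xi. *)
Definition is_frame (R : realType) (n : nat) (xi : 'rV[R]_n)
    (U : 'M[R]_(n.-1, n)) : Prop :=
  U *m U^T = 1%:M /\ U *m xi^T = 0.

(* Existence, from the Householder reflection exchanging the first basis
   vector and xi. *)
Lemma is_frame_ex (R : realType) (n : nat) (xi : 'rV[R]_n) :
  (0 < n)%N -> esphere xi -> exists U, is_frame xi U.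
Proof.
case: n xi => // n xi _ xi1.
have dotE (x y : 'rV[R]_n.+1) : x *m y^T = (dot x y)%:M.
  by rewrite [LHS]mx11_scalar mxE; congr (_%:M); apply: eq_bigr => i _; rewrite mxE.
have xx : dot xi xi = 1.
  have d0 : 0 <= dot xi xi by apply: sumr_ge0 => i _; rewrite -expr2 sqr_ge0.
  by rewrite -(sqr_sqrtr d0) -/(enorm xi) xi1 expr1n.
pose e : 'rV[R]_n.+1 := delta_mx ord0 ord0.
pose v := xi - e.
pose q := dot v v.
have ex x : dot e x = x ord0 ord0.
  rewrite /dot (bigD1 ord0)//= big1 ?addr0; last first.
    by move=> i i0; rewrite mxE eqxx/= (negbTE i0) mul0r.
  by rewrite mxE !eqxx mul1r.
have qE : q = - 2 * dot e v.
  have -> : q = dot xi xi - 2 * dot e xi + dot e e.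
    rewrite /q /dot mulr_sumr -sumrB -big_split/=; apply: eq_bigr => i _.
    by rewrite !mxE; ring.
  by rewrite xx !ex !mxE /= ; ring.
pose c := 2 / q.
pose H : 'M[R]_n.+1 := 1%:M - c *: (v^T *m v).
have cq : c *: (q *: v) = 2 *: v.
  have [q0|q0] := eqVneq q 0; last by rewrite scalerA divfK.
  suff -> : v = 0 by rewrite !scaler0.
  apply/rowP => i; rewrite [RHS]mxE; apply/eqP; rewrite -sqrf_eq0.
  move: q0; rewrite /q /dot => /eqP.
  rewrite psumr_eq0 => [/allP/(_ i)|j _]; last by rewrite -expr2 sqr_ge0.
  by rewrite mem_index_enum -expr2 => /(_ isT).
have HT : H^T = H by rewrite /H linearB linearZ/= trmx_mul trmxK trmx1.
have vH : v *m H = - v.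
  rewrite /H mulmxBr mulmx1 -scalemxAr mulmxA dotE mul_scalar_mx -/q cq.
  by rewrite scaler_nat mulr2n opprD addNKr.
have HH : H *m H = 1%:M.
  rewrite {1}/H mulmxBl mul1mx -scalemxAl -mulmxA vH mulmxN scalerN opprK.
  by rewrite /H subrK.
have eH : e *m H = xi.
  rewrite /H mulmxBr mulmx1 -scalemxAr mulmxA dotE mul_scalar_mx.
  have -> : dot e v = - (q / 2) by rewrite qE; field.
  rewrite scaleNr scalerN opprK.
  have -> : c *: (q / 2 *: v) = 2^-1 *: (c *: (q *: v)).
    by rewrite !scalerA; congr (_ *: _); ring.
  by rewrite cq scalerA mulVf ?pnatr_eq0// scale1r /v addrC subrK.
pose P : 'M[R]_(n, n.+1) := rowsub (lift ord0) 1%:M.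
exists (P *m H); split.
  rewrite trmx_mul HT mulmxA -(mulmxA P) HH mulmx1 mul_rowsub_mx mul1mx.
  by apply/matrixP => i j; rewrite !mxE (inj_eq lift_inj) eq_sym.
rewrite -eH trmx_mul HT mulmxA -(mulmxA P) HH mulmx1 mul_rowsub_mx mul1mx.
by apply/matrixP => i j; rewrite !mxE andbF.
Qed.

(* By rotation invariance of Lebesgue measure, hvol does not depend on the
   chosen frame. *)
Definition frame (R : realType) (n : nat) (xi : 'rV[R]_n) : 'M[R]_(n.-1, n) :=
  xget 0 [set U | is_frame xi U].

(* (n-1)-dimensional volume of a subset of hyperplane xi. *)
Definition hvol (R : realType) (n : nat) (xi : 'rV[R]_n) (A : set 'rV[R]_n) :
    \bar R :=
  vol [set y : 'rV[R]_(n.-1) | A (y *m frame xi)].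

Definition minkowski_functional (R : realType) (n : nat) (K : set 'rV[R]_n)
    (x : 'rV[R]_n) : R :=
  inf [set a : R | 0 <= a /\ [set a *: y | y in K] x].

Definition radial (R : realType) (n : nat) (K : set 'rV[R]_n)
    (x : 'rV[R]_n) : R := (minkowski_functional K x)^-1.

Definition boundary (R : realType) (n : nat) (K : set 'rV[R]_n) :
    set 'rV[R]_n := closure K `\` K°.

Definition star_body (R : realType) (n : nat) (K : set 'rV[R]_n) : Prop :=
  [/\ closed K,
      bounded_set K,
      (forall u : 'rV[R]_n, u != 0 ->
        (range (fun t : R => t *: u) `&` boundary K `\ 0) #= `I_2),
      K° 0
    & continuous (minkowski_functional K)].

Definition origin_symmetric (R : realType) (n : nat) (K : set 'rV[R]_n) : Prop :=
  [set - x | x in K] = K.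

Definition sym_star_body (R : realType) (n : nat) (K : set 'rV[R]_n) : Prop :=
  star_body K /\ origin_symmetric K.

Definition is_intersection_body_of (R : realType) (n : nat)
    (K L : set 'rV[R]_n) : Prop :=
  forall xi, esphere xi -> (radial K xi)%:E = hvol xi (L `&` hyperplane xi).

Definition radial_dist (R : realType) (n : nat) (K L : set 'rV[R]_n) : R :=
  sup [set `|radial K xi - radial L xi| | xi in @esphere R n].

Definition intersection_body (R : realType) (n : nat) (K : set 'rV[R]_n) : Prop :=
  sym_star_body K /\
  forall e : R, 0 < e -> exists M L : set 'rV[R]_n,
    [/\ sym_star_body M, sym_star_body L, is_intersection_body_of M L
      & radial_dist K M < e].

Definition stab_const (R : realType) (n : nat) : R :=
  fine (vol (@eball R n)) `^ (n.-1%:R / n%:R) / fine (vol (@eball R n.-1)).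

(* Main.v *)
Require Import Defs.
From HB Require Import structures.
From mathcomp Require Import all_boot all_order all_algebra.
From mathcomp Require Import ring lra.
From mathcomp Require Import all_classical all_reals all_analysis.
From mathcomp Require Import measurable_realfun.
Set Implicit Arguments.
Unset Strict Implicit.
Unset Printing Implicit Defensive.
Import Order.TTheory GRing.Theory Num.Theory.
Import numFieldNormedType.Exports.
Local Open Scope classical_set_scope.
Local Open Scope ring_scope.

(** Write rho_A for the radial function of A and, for points x with nonzero
    first coordinate, R_A(x) = |A cap x^perp| / |x|.

    The hyperplane x^perp is the graph of y |-> - <x', y> / x_1 over the last
    n - 1 coordinates, so that R_A(x) is |x_1|^-1 times the volume of the set
    of all y such that (- <x', y> / x_1, y) lies in A ([integral_frame],
    [radon_hvol]). In these coordinates the integral of R_A over D is a triple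
    integral in x', y and s = x_1 against dx' dy ds / |s|, and exchanging A
    and D amounts to the substitution s -> - <x', y> / s, which preserves
    ds / |s|. Hence int_D R_A = int_A R_D ([radon_symm]): this is the
    self-adjointness of the spherical Radon transform, without the sphere.

    If M is the intersection body of D, then R_D = rho_M by homogeneity.
    Integrating |K cap xi^perp| <= |L cap xi^perp| + eps over D with the weight
    1 / |x|, and observing that R_B(x) = |B^(n-1)| / |x| for the unit ball B,
    one gets
      int_K rho_M <= int_L rho_M + eps / |B^(n-1)| * int_B rho_M.
    The body K is a limit of such M, and rho_K may replace rho_M up to factors
    1 - d and 1 + d with d arbitrarily small ([radial_int_compare]).

    Finally rho_K >= 1/t on the dilate tK and rho_K <= 1/t outside, so that tK
    maximises int_A rho_K among the sets A of its own volume
    ([radial_int_bathtub]). As int_(tK) rho_K = t^(n-1) int_K rho_K, this says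
      int_A rho_K <= (|A| / |K|)^((n-1)/n) * int_K rho_K,
    which is used for A = L and A = B. For n >= 2 the integral of rho_K over K
    is positive and finite, and dividing by it leaves the assertion with the
    constant |B|^((n-1)/n) / |B^(n-1)|. *)

(** * Lebesgue measure on row vectors *)

Definition row_of_tuple (R : realType) n (t : n.-tuple (measurableTypeR R)) :
  'rV[R]_n := \row_i tnth t i.

Fact rV_display : measure_display. Proof. exact: default_measure_display. Qed.

Section rV_measurable.
Context (R : realType) (n : nat).

(** Transported from tuples, so that the volume becomes an image measure to
    which Fubini applies coordinate by coordinate. *)
Definition measurable_rV : set (set 'rV[R]_n) :=
  [set A | measurable (@row_of_tuple R n @^-1` A)].

Let m0 : measurable_rV set0.
Proof. by rewrite /measurable_rV /= preimage_set0. Qed.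

Let mC A : measurable_rV A -> measurable_rV (~` A).
Proof. by rewrite /measurable_rV/= preimage_setC; exact: measurableC. Qed.

Let mU (F : (set 'rV[R]_n)^nat) : (forall i, measurable_rV (F i)) ->
  measurable_rV (\bigcup_i F i).
Proof.
by move=> mF; rewrite /measurable_rV/= preimage_bigcup;
  apply: bigcup_measurable => i _; exact: mF.
Qed.

HB.instance Definition _ :=
  @isMeasurable.Build rV_display 'rV[R]_n measurable_rV m0 mC mU.

End rV_measurable.

Section rV_measurable_fun.
Context (R : realType).

Lemma measurable_row_of_tuple n : measurable_fun setT (@row_of_tuple R n).
Proof. by move=> _ A mA; rewrite setTI. Qed.

Definition tuple_of_row n (x : 'rV[R]_n) : n.-tuple (measurableTypeR R) :=
  [tuple x ord0 i | i < n].

Lemma row_of_tupleK n : cancel (@row_of_tuple R n) (@tuple_of_row n).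
Proof. by move=> t; apply: eq_from_tnth => i; rewrite tnth_mktuple mxE. Qed.

Lemma tuple_of_rowK n : cancel (@tuple_of_row n) (@row_of_tuple R n).
Proof. by move=> t; apply/rowP => i; rewrite mxE tnth_mktuple. Qed.

Lemma measurable_coord n (i : 'I_n) :
  measurable_fun setT (fun x : 'rV[R]_n => x ord0 i : measurableTypeR R).
Proof.
move=> _ A mA; rewrite setTI /measurable/= /measurable_rV/=.
rewrite (_ : _ @^-1` _ = (fun t => tnth t i) @^-1` A).
  by rewrite -[X in measurable X]setTI; exact: (measurable_tnth i).
by apply/seteqP; split => t /=; rewrite mxE.
Qed.

Lemma measurable_rVP d (T : measurableType d) n (f : T -> 'rV[R]_n) :
  (forall i, measurable_fun setT (fun t => f t ord0 i : measurableTypeR R)) ->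
    measurable_fun setT f.
Proof.
move=> mf.
rewrite (_ : f = @row_of_tuple R n \o (@tuple_of_row n \o f));
  last by apply/funext => x /=; rewrite tuple_of_rowK.
apply: measurableT_comp; first exact: measurable_row_of_tuple.
apply/measurable_fun_tnthP => i.
by rewrite (_ : _ \o _ = (fun t => f t ord0 i))//; apply/funext => x /=;
  rewrite tnth_mktuple.
Qed.

End rV_measurable_fun.

Section leb.
Context (R : realType) (n : nat).

HB.instance Definition _ :=
  @isMeasurableFun.Build _ _ _ _ (@row_of_tuple R n)
  (@measurable_row_of_tuple R n).

Definition leb : set 'rV[R]_n -> \bar R :=
  pushforward (power_measure (@lebesgue_measure R) n) (@row_of_tuple R n).

Let leb0 : leb set0 = 0%E. Proof. exact: measure0. Qed.
Let leb_ge0 A : (0 <= leb A)%E. Proof. exact: measure_ge0. Qed.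

Let leb_sigma_additive : semi_sigma_additive leb.
Proof. exact: measure_semi_sigma_additive. Qed.

HB.instance Definition _ :=
  isMeasure.Build _ _ _ leb leb0 leb_ge0 leb_sigma_additive.

Let leb_sigma_finite : sigma_finite setT leb.
Proof.
have [F FT mF] := sigma_finiteT (power_measure (@lebesgue_measure R) n).
have E A : @row_of_tuple R n @^-1` (@tuple_of_row R n @^-1` A) = A.
  by apply/seteqP; split => x /=; rewrite row_of_tupleK.
exists (fun k => @tuple_of_row R n @^-1` F k).
  by rewrite -preimage_bigcup -FT preimage_setT.
move=> k; have [mFk Fk] := mF k; split;
  rewrite /measurable/= /measurable_rV/leb/pushforward/=; by rewrite E.
Qed.

HB.instance Definition _ :=
  Measure_isSigmaFinite.Build _ _ _ leb leb_sigma_finite.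

Lemma lebE A : leb A = vol A. Proof. by []. Qed.

End leb.

(** The curried integrand lets this equation be used for rewriting. *)
Lemma tonelli_swap d1 d2 (T1 : measurableType d1) (T2 : measurableType d2)
  (R : realType)
  (m1 : {sigma_finite_measure set T1 -> \bar R})
    (m2 : {sigma_finite_measure set T2 -> \bar R})
  (f : T1 -> T2 -> \bar R) :
  measurable_fun setT (fun p : T1 * T2 => f p.1 p.2) ->
    (forall x y, 0 <= f x y)%E ->
  (\int[m1]_x \int[m2]_y f x y = \int[m2]_y \int[m1]_x f x y)%E.
Proof. by move=> mf f0; exact: (fubini_tonelli (fun p => f p.1 p.2)). Qed.

Section product.
Context (R : realType).
Local Open Scope ereal_scope.
Local Notation mu := (@lebesgue_measure R).

Definition rowcons n (s : R) (x : 'rV[R]_n) : 'rV[R]_n.+1 :=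
  \row_i if unlift ord0 i is Some j then x ord0 j else s.

Lemma rowcons0 n s (x : 'rV[R]_n) : rowcons s x ord0 ord0 = s.
Proof. by rewrite mxE unlift_none. Qed.

Lemma rowconsS n s (x : 'rV[R]_n) i : rowcons s x ord0 (lift ord0 i) = x ord0 i.
Proof. by rewrite mxE liftK. Qed.

Definition rowtail n (x : 'rV[R]_n.+1) : 'rV[R]_n :=
  (\row_i x ord0 (lift ord0 i))%R.

Lemma rowtailK n (x : 'rV[R]_n.+1) : rowcons (x ord0 ord0) (rowtail x) = x.
Proof.
by apply/rowP => i; have [j ->|->] := unliftP ord0 i;
  rewrite ?rowconsS ?rowcons0 ?mxE.
Qed.

Lemma rowconsK n s (x : 'rV[R]_n) : rowtail (rowcons s x) = x.
Proof. by apply/rowP => i; rewrite mxE rowconsS. Qed.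

Lemma measurable_rowtail n : measurable_fun setT (@rowtail n).
Proof.
by apply: measurable_rVP => i; under eq_fun do rewrite mxE;
  exact: measurable_coord.
Qed.

Lemma row_of_tuple_tcons n (s : R) (x : n.-tuple _) :
  row_of_tuple (tcons (s, x)) = rowcons s (row_of_tuple x).
Proof.
apply/rowP => i; rewrite mxE.
have [j ->|->] := unliftP ord0 i; first by rewrite rowconsS tnthS mxE.
by rewrite rowcons0.
Qed.

Lemma measurable_rowcons d (T : measurableType d) n (f : T -> measurableTypeR R)
  (g : T -> 'rV[R]_n) :
  measurable_fun setT f -> measurable_fun setT g ->
    measurable_fun setT (fun x => rowcons (f x) (g x)).
Proof.
move=> mf mg; apply: measurable_rVP => i.
have [j ->|->] := unliftP ord0 i.
  under eq_fun do rewrite rowconsS.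
  exact: (measurableT_comp (measurable_coord j) mg).
by under eq_fun do rewrite rowcons0.
Qed.

Lemma integral_leb n (f : 'rV[R]_n -> \bar R) : measurable_fun setT f ->
  (forall x, 0 <= f x) ->
  \int[leb (n:=n)]_x f x = \int[power_measure mu n]_t f (row_of_tuple t).
Proof.
move=> mf f0; rewrite [LHS](ge0_integral_pushforward
  (measurable_row_of_tuple (n:=n)))//.
Qed.

Lemma integral_rowcons n (f : 'rV[R]_n.+1 -> \bar R) : measurable_fun setT f ->
  (forall x, 0 <= f x) ->
  \int[leb (n:=n.+1)]_x f x = \int[mu]_s \int[leb (n:=n)]_x f (rowcons s x).
Proof.
move=> mf f0; rewrite integral_leb//.
have mft : measurable_fun setT (f \o @row_of_tuple R n.+1) by
  exact: measurableT_comp mf (@measurable_row_of_tuple _ _).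
rewrite [LHS](ge0_integral_pushforward (@measurable_tcons _ _ n))//
  preimage_setT.
have mftc := measurableT_comp mft (@measurable_tcons _ (measurableTypeR R) n).
rewrite (fubini_tonelli1 _ mftc)//; last by move=> x; exact: f0.
apply: eq_integral => s _; rewrite /fubini_F/= integral_leb//.
  by apply: eq_integral => x _; rewrite row_of_tuple_tcons.
apply: (measurableT_comp mf); exact: measurable_rowcons.
Qed.

Lemma integral_rowcons2 n (f : 'rV[R]_n.+1 -> \bar R) : measurable_fun setT f ->
  (forall x, 0 <= f x) ->
  \int[leb (n:=n.+1)]_x f x = \int[leb (n:=n)]_x \int[mu]_s f (rowcons s x).
Proof.
move=> mf f0; rewrite integral_rowcons//.
pose g (p : measurableTypeR R * 'rV[R]_n) := f (rowcons p.1 p.2).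
have mg : measurable_fun setT g by apply: (measurableT_comp mf);
  exact: measurable_rowcons.
by rewrite -[LHS](fubini_tonelli1 _ mg) ?(fubini_tonelli2 _ mg)// => x;
  exact: f0.
Qed.

End product.

(** * Affine changes of variable *)

Section affine.
Context (R : realType).
Local Open Scope ereal_scope.
Local Notation mu := (@lebesgue_measure R).

Lemma lebesgue_affine_gt0 (a b : R) (f : R -> \bar R) : (0 < a)%R ->
  measurable_fun setT f -> (forall x, 0 <= f x) ->
  \int[mu]_s f (a * s + b)%R = (a^-1)%:E * \int[mu]_s f s.
Proof.
move=> a0 mf f0.
pose phi (s : measurableTypeR R) : measurableTypeR R := (a * s + b)%R.
have mphi : measurable_fun setT phi.
  apply: measurable_funD; last exact: measurable_cst.
  apply: measurable_funM => //; exact: measurable_cst.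
pose k := NngNum (ltW a0).
pose nu0 := (mscale k (pushforward mu phi) : {measure set (measurableTypeR R) ->
  \bar R}).
pose nu := nu0 mphi.
have E A : measurable A -> mu A = nu A.
  apply: lebesgue_measure_unique => _ [[x y] _ <-].
  rewrite /nu/nu0/= /mscale/= /pushforward.
  rewrite (_ : phi @^-1` _ = `](x - b) / a, (y - b) / a]%classic)%R; last first.
    apply/seteqP; split => s /=;
      rewrite !in_itv/= ltr_pdivrMr// ler_pdivlMr// ltrBlDr lerBrDr;
    by rewrite /phi mulrC.
  rewrite !lebesgue_measure_itv/= !lte_fin ltr_pM2r ?invr_gt0// ltrD2r.
  case: ifPn => _; last by rewrite mule0.
  by rewrite -!EFinB -EFinM; congr (_%:E); field; rewrite gt_eqF.
rewrite [in RHS](eq_measure_integral nu); last by move=> A mA _; exact: E.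
rewrite ge0_integral_mscale// ge0_integral_pushforward// muleA -EFinM mulVf
  ?gt_eqF// mul1e.
by rewrite preimage_setT.
Qed.

Lemma lebesgue_affine (a b : R) (f : R -> \bar R) : a != 0%R ->
  measurable_fun setT f -> (forall x, 0 <= f x) ->
  \int[mu]_s f (a * s + b)%R = (`|a|^-1)%:E * \int[mu]_s f s.
Proof.
move=> a0 mf f0; have [ap|an|a00] := ltgtP a 0%R;
  last by rewrite a00 eqxx in a0.
  have E (g : R -> \bar R) : measurable_fun setT g -> (forall x, 0 <= g x) ->
    \int[mu]_s g (- s)%R = \int[mu]_s g s.
    move=> mg g0.
    have mN : measurable_fun setT (-%R : measurableTypeR R -> measurableTypeR R)
      by exact: oppr_measurable.
    rewrite [RHS](eq_measure_integral
      (pushforward mu (-%R : _ -> measurableTypeR R))); last first.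
      by move=> A mA _; rewrite [RHS]lebesgue_measureN.
    by rewrite (ge0_integral_pushforward mN)// preimage_setT.
  pose g (s : R) := f (- a * s + b)%R.
  have mg : measurable_fun setT g.
    apply: measurableT_comp => //; apply: measurable_funD;
      last exact: measurable_cst.
    by apply: measurable_funM => //; exact: measurable_cst.
  rewrite ltr0_norm// -(lebesgue_affine_gt0 b _ mf)// ?oppr_gt0//.
  rewrite -[RHS](E g)//; last by move=> x; exact: f0.
  by apply: eq_integral => s _; rewrite /g mulrNN.
by rewrite gtr0_norm// lebesgue_affine_gt0.
Qed.

Lemma measurable_affine n (a : R) (b : 'rV[R]_n) :
  measurable_fun setT (fun x : 'rV[R]_n => a *: x + b)%R.
Proof.
apply: measurable_rVP => i; under eq_fun do rewrite !mxE.
apply: measurable_funD; last exact: measurable_cst.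
by apply: measurable_funM; [exact: measurable_cst|exact: measurable_coord].
Qed.

Lemma rowcons_affine n (a s : R) (x : 'rV[R]_n) (b : 'rV[R]_n.+1) :
  (a *: rowcons s x + b = rowcons (a * s + b ord0 ord0) (a *: x + rowtail b))%R.
Proof.
apply/rowP => i; rewrite !mxE.
by have [j ->|->] := unliftP ord0 i; rewrite ?liftK ?unlift_none ?mxE.
Qed.

Lemma integral_affine n (a : R) (b : 'rV[R]_n) (f : 'rV[R]_n -> \bar R) :
  a != 0%R ->
  measurable_fun setT f -> (forall x, 0 <= f x) ->
  \int[leb (n:=n)]_x f (a *: x + b)%R = ((`|a|^-1) ^+ n)%:E * \int[leb (n:=n)]_x
    f x.
Proof.
move=> a0; elim: n b f => [|n IH] b f mf f0.
  by rewrite expr0 mul1e; apply: eq_integral => x _; congr f;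
    rewrite (thinmx0 x) (thinmx0 (_ + b)%R).
rewrite integral_rowcons//;
  last exact: (measurableT_comp mf (@measurable_affine _ a b)).
rewrite integral_rowcons//.
pose F s := \int[leb (n:=n)]_x f (rowcons s x).
have F0 s : 0 <= F s by apply: integral_ge0.
have mF : measurable_fun setT F.
  apply: (measurable_fun_fubini_tonelli_F (fun p => f (rowcons p.1 p.2))) => //.
  by apply: (measurableT_comp mf); exact: measurable_rowcons.
transitivity (\int[mu]_s (((`|a|^-1) ^+ n)%:E * F (a * s + b ord0 ord0)%R)).
  apply: eq_integral => s _; under eq_integral do rewrite rowcons_affine.
  rewrite (IH _ (fun x => f (rowcons _ x)))//.
  by apply: (measurableT_comp mf); apply: measurable_rowcons => //;
    exact: measurable_cst.
rewrite ge0_integralZl//.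
- by rewrite lebesgue_affine// muleA -EFinM -exprSr.
- apply: (measurableT_comp mF); apply: measurable_funD;
  last exact: measurable_cst.
  by apply: measurable_funM => //; exact: measurable_cst.
Qed.

End affine.

(** * Borel sets of row vectors *)

Section measurability.
Context (R : realType).

(** An open set is the union of the countably many cubes with rational centre
    and radius 1 / (k + 1) that it contains. *)
Lemma open_measurable_rV n (A : set 'rV[R]_n) : open A -> measurable A.
Proof.
move=> oA.
pose F (p : 'rV[rat]_n * nat) : set 'rV[R]_n :=
  let B := \bigcap_(i in [set: 'I_n])
    [set y : 'rV[R]_n | `|ratr (p.1 ord0 i) - y ord0 i| < p.2.+1%:R^-1] in
  if pselect (B `<=` A) then B else set0.
rewrite (_ : A = \bigcup_p F p).
  apply: countable_bigcupT_measurable => // p; rewrite /F;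
    case: pselect => //= _.
  apply: fin_bigcap_measurable => // i _.
  rewrite -[X in measurable X]setTI.
  rewrite (_ : [set y | _] = (fun y : 'rV[R]_n => y ord0 i) @^-1` ball
    (ratr (p.1 ord0 i) : R) p.2.+1%:R^-1)//.
  by apply: measurable_coord => //; exact: measurable_ball.
apply/seteqP; split => [x Ax|x [p _]]; last by rewrite /F;
  case: pselect => //= sBA /sBA.
have /nbhs_ballP[e /= e0 xeA] : nbhs x A by exact: open_nbhs_nbhs.
have [k ke] : exists k, k.+1%:R^-1 < e / 2 :> R.
  have [k _ /(_ k (leqnn k))] :=
    near_infty_natSinv_lt (PosNum (divr_gt0 e0 (ltr0n _ 2))).
  by exists k.
have k0 : 0 < k.+1%:R^-1 :> R by rewrite invr_gt0.
have Q (i : 'I_n) : exists q : rat, `|ratr q - x ord0 i| < k.+1%:R^-1.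
  have [q] := @rat_in_itvoo R (x ord0 i - k.+1%:R^-1) (x ord0 i + k.+1%:R^-1)
    ltac:(by rewrite ltrD2l gtrN).
  rewrite in_itv/= => /andP[q1 q2]; exists q; by rewrite ltr_distl q1 q2.
pose q : 'rV[rat]_n := \row_i projT1 (cid (Q i)).
exists (q, k) => //; rewrite /F; case: pselect => /= [_ i _|[]] /=.
  by rewrite mxE; exact: projT2 (cid (Q i)).
move=> y yB; apply: xeA; split=> // i j; rewrite (ord1 i)/ball/=.
have := yB j Logic.I; rewrite /= mxE; have := projT2 (cid (Q j));
  set z := ratr _ => h1 h2.
have -> : x ord0 j - y ord0 j = (z - y ord0 j) - (z - x ord0 j) by ring.
apply: le_lt_trans (ler_normB _ _) _.
by rewrite (splitr e) ltrD// (lt_trans _ ke).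
Qed.

Lemma closed_measurable_rV n (A : set 'rV[R]_n) : closed A -> measurable A.
Proof.
move=> cA; rewrite -[A]setCK; apply: measurableC;
  apply: open_measurable_rV; exact: closed_openC.
Qed.

Lemma continuous_measurable_rV n (f : 'rV[R]_n -> R) : continuous f ->
  measurable_fun setT (f : _ -> measurableTypeR R).
Proof.
move=> cf; apply: (measurability _ (RGenOpens.measurableE R)).
move=> _ [_ [a [b ->] <-]]; rewrite setTI.
by apply: open_measurable_rV; move/continuousP: cf; apply; exact: itv_open.
Qed.

Lemma measurable_addrV d (T : measurableType d) n (f g : T -> 'rV[R]_n) :
  measurable_fun setT f -> measurable_fun setT g ->
    measurable_fun setT (fun x => f x + g x).
Proof.
move=> mf mg; apply: measurable_rVP => i; under eq_fun do rewrite mxE.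
by apply: measurable_funD; [exact: (measurableT_comp (measurable_coord i) mf)
                           |exact: (measurableT_comp (measurable_coord i) mg)].
Qed.

Lemma measurable_scalerV d (T : measurableType d) n (a : T -> R)
  (f : T -> 'rV[R]_n) :
  measurable_fun setT a -> measurable_fun setT f ->
    measurable_fun setT (fun x => a x *: f x).
Proof.
move=> ma mf; apply: measurable_rVP => i; under eq_fun do rewrite mxE.
by apply: measurable_funM => //;
  exact: (measurableT_comp (measurable_coord i) mf).
Qed.

Lemma measurable_opprV d (T : measurableType d) n (f : T -> 'rV[R]_n) :
  measurable_fun setT f -> measurable_fun setT (fun x => - f x).
Proof.
move=> mf; under eq_fun do rewrite -scaleN1r.
by apply: measurable_scalerV => //; exact: measurable_cst.
Qed.

Lemma measurable_mulmxr d (T : measurableType d) m n (Q : 'M[R]_(m, n))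
  (f : T -> 'rV[R]_m) :
  measurable_fun setT f -> measurable_fun setT (fun x => f x *m Q).
Proof.
move=> mf; apply: measurable_rVP => i; under eq_fun do rewrite mxE.
apply: measurable_sum => j; apply: measurable_funM; last exact: measurable_cst.
exact: (measurableT_comp (measurable_coord j) mf).
Qed.

Lemma measurable_dot d (T : measurableType d) n (f g : T -> 'rV[R]_n) :
  measurable_fun setT f -> measurable_fun setT g ->
    measurable_fun setT (fun x => dot (f x) (g x)).
Proof.
move=> mf mg; apply: measurable_sum => j; apply: measurable_funM.
  exact: (measurableT_comp (measurable_coord j) mf).
exact: (measurableT_comp (measurable_coord j) mg).
Qed.

End measurability.

(** * Euclidean norm *)

Section euclidean.
Context (R : realType).

Lemma dotxx_ge0 n (x : 'rV[R]_n) : (0 <= dot x x)%R.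
Proof. by apply: sumr_ge0 => i _; rewrite -expr2 sqr_ge0. Qed.

Lemma enorm_sqr n (x : 'rV[R]_n) : (enorm x ^+ 2 = dot x x)%R.
Proof. by rewrite sqr_sqrtr// dotxx_ge0. Qed.

Lemma enorm_ge0 n (x : 'rV[R]_n) : (0 <= enorm x)%R.
Proof. exact: sqrtr_ge0. Qed.

Lemma enormZ n a (x : 'rV[R]_n) : (enorm (a *: x) = `|a| * enorm x)%R.
Proof.
have -> : enorm (a *: x) = Num.sqrt (a ^+ 2 * dot x x).
  congr Num.sqrt; rewrite /dot mulr_sumr; apply: eq_bigr => i _; rewrite !mxE;
    ring.
by rewrite sqrtrM ?sqr_ge0// sqrtr_sqr.
Qed.

Lemma dot_mulmx n (x y : 'rV[R]_n) : (x *m y^T = (dot x y)%:M)%R.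
Proof.
by rewrite [LHS]mx11_scalar mxE; congr (_%:M)%R; apply: eq_bigr => i _;
  rewrite mxE.
Qed.

Lemma enorm_frame m n (U : 'M[R]_(m, n)) (x : 'rV[R]_m) : (U *m U^T = 1%:M)%R ->
  enorm (x *m U)%R = enorm x.
Proof.
move=> UU; rewrite /enorm; congr (Num.sqrt _).
have := dot_mulmx (x *m U) (x *m U);
  rewrite trmx_mul mulmxA -(mulmxA x) UU mulmx1 dot_mulmx.
by move=> /matrixP/(_ ord0 ord0); rewrite !mxE.
Qed.

Lemma coord_le_enorm n (x : 'rV[R]_n) i : (`|x ord0 i| <= enorm x)%R.
Proof.
rewrite -ler_sqr ?nnegrE ?enorm_ge0// enorm_sqr /dot (bigD1 i)//= real_normK
  ?num_real// -expr2 lerDl.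
by apply: sumr_ge0 => j _; rewrite -expr2 sqr_ge0.
Qed.

Lemma enorm0 n : enorm (0 : 'rV[R]_n) = 0.
Proof. by rewrite -(scale0r 0) enormZ normr0 mul0r. Qed.

Lemma enorm_eq0 n (x : 'rV[R]_n) : enorm x = 0 -> x = 0.
Proof.
move=> x0; apply/rowP => i; rewrite mxE; apply/eqP; rewrite -normr_le0 -x0;
  exact: coord_le_enorm.
Qed.

Lemma enorm_gt0 n (x : 'rV[R]_n) : x != 0 -> 0 < enorm x.
Proof.
by move=> x0; rewrite lt_neqAle enorm_ge0 andbT eq_sym;
  apply: contra x0 => /eqP/enorm_eq0/eqP.
Qed.

Lemma enorm_normalize n (x : 'rV[R]_n) : x != 0 ->
  enorm ((enorm x)^-1 *: x) = 1.
Proof.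
by move=> /enorm_gt0 x0; rewrite enormZ ger0_norm ?invr_ge0 ?(ltW x0)// mulVf//
  gt_eqF.
Qed.

Lemma dot_rowcons n (s t : R) (x y : 'rV[R]_n) :
  dot (rowcons s x) (rowcons t y) = (s * t + dot x y)%R.
Proof.
rewrite /dot big_ord_recl !rowcons0; congr (_ + _)%R.
by apply: eq_bigr => i _; rewrite !rowconsS.
Qed.

Definition basis0 n : 'rV[R]_n.+1 := delta_mx ord0 ord0.

Lemma dot_basis0 n (x : 'rV[R]_n.+1) : dot (basis0 n) x = x ord0 ord0.
Proof.
rewrite /dot (bigD1 ord0)//= big1 ?addr0; last first.
  by move=> i i0'; rewrite mxE eqxx/= (negbTE i0') mul0r.
by rewrite mxE !eqxx mul1r.
Qed.

Lemma basis0_neq0 n : basis0 n ord0 ord0 != 0.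
Proof. by rewrite mxE !eqxx oner_neq0. Qed.

Lemma coord0_neq0 n (x : 'rV[R]_n.+1) : x ord0 ord0 != 0 -> x != 0.
Proof. by apply: contra => /eqP ->; rewrite mxE. Qed.

Lemma frame_hyperplane n (xi : 'rV[R]_n.+1) (U : 'M[R]_(n, n.+1)) z :
  is_frame xi U -> hyperplane xi (z *m U).
Proof.
move=> [_ Uxi]; rewrite /hyperplane/=.
have := dot_mulmx (z *m U) xi;
  rewrite -mulmxA Uxi mulmx0 => /matrixP/(_ ord0 ord0).
by rewrite !mxE mulr1n.
Qed.

End euclidean.

(** * Balls and orthogonal invariance *)

Section invariance.
Context (R : realType).
Local Open Scope ereal_scope.
Local Notation mu := (@lebesgue_measure R).

Definition box n (r : R) : set 'rV[R]_n :=
  [set x | forall i, (`|x ord0 i| <= r)%R].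

Lemma measurable_box n r : measurable (@box n r).
Proof.
rewrite (_ : @box n r = \bigcap_(i in [set: 'I_n])
  [set x | (`|x ord0 i| <= r)%R]); last first.
  by apply/seteqP; split => x /= xr i => [_|]; exact: xr.
apply: fin_bigcap_measurable => // i _.
have := @measurable_coord R n i measurableT _ (measurable_itv `[(- r)%R, r]).
rewrite setTI; congr (measurable _).
by apply/seteqP; split => x /=; rewrite in_itv/= ler_norml.
Qed.

Lemma leb_indic n (A : set 'rV[R]_n) : measurable A ->
  leb A = \int[leb (n:=n)]_x (\1_A x)%:E.
Proof. by move=> mA; rewrite integral_indic// setIT. Qed.

Lemma measurable_EFin_indic d (T : measurableType d) (A : set T) :
  measurable A -> measurable_fun setT (fun x => (\1_A x : R)%:E).
Proof. by move=> mA; apply/measurable_EFinP; exact: measurable_indic. Qed.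

Lemma EFin_indic_ge0 T (A : set T) x : 0 <= (\1_A x : R)%:E.
Proof. by rewrite lee_fin. Qed.

Lemma enorm_le_coord n (x : 'rV[R]_n) (r : R) : (0 <= r)%R -> box r x ->
  (enorm x <= n%:R * r)%R.
Proof.
move=> r0 xr; rewrite -ler_sqr ?nnegrE ?enorm_ge0 ?mulr_ge0// enorm_sqr.
apply: (@le_trans _ _ (n%:R * r ^+ 2)%R); last first.
  rewrite exprMn; apply: ler_wpM2r; first exact: sqr_ge0.
  by rewrite -natrX ler_nat -mulnn; case: (n) => // k; rewrite leq_pmulr.
apply: (@le_trans _ _ (\sum_(i < n) r ^+ 2)%R);
  last by rewrite sumr_const card_ord mulr_natl lexx.
apply: ler_sum => i _; rewrite -expr2 -(@real_normK _ (x _ _)) ?num_real//.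
by rewrite lerXn2r ?nnegrE// xr.
Qed.

Lemma leb_box n (r : R) : (0 <= r)%R -> leb (@box n r) = ((2 * r) ^+ n)%:E.
Proof.
move=> r0; elim: n => [|n IH].
  rewrite expr0 lebE /vol /= diracE mem_set// => -[]//.
have mB m : measurable (@box m r) by exact: measurable_box.
have mI m : measurable_fun setT (fun x : 'rV[R]_m => (\1_(@box m r) x : R)%:E)
  by apply: measurable_EFin_indic; exact: mB.
rewrite leb_indic// integral_rowcons//.
transitivity (\int[mu]_s (((2 * r) ^+ n)%:E * (\1_(`[(-r)%R, r]%classic)
  s)%:E)).
  apply: eq_integral => s _; rewrite -IH leb_indic//.
  rewrite -ge0_integralZr//; last exact: mI.
  apply: eq_integral => x _; rewrite -EFinM; congr (_%:E).
  rewrite !indicE -natrM mulnb; congr (_%:R); congr (nat_of_bool _).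
  apply/idP/andP => [/set_mem sx|[/set_mem xr /set_mem sr]].
    split; apply/mem_set; first by move=> i; have := sx (lift ord0 i);
      rewrite rowconsS.
    by have := sx ord0; rewrite rowcons0/= in_itv/= ler_norml.
  apply/mem_set => i; have [j ->|->] := unliftP ord0 i;
    first by rewrite rowconsS.
  by rewrite rowcons0 ler_norml; move: sr; rewrite /= in_itv.
rewrite ge0_integralZl//; last 2 first.
- exact: measurable_EFin_indic.
- by rewrite lee_fin exprn_ge0// mulr_ge0.
rewrite integral_indic//= setIT lebesgue_measure_itv/= lte_fin.
case: ifPn => [_|]; first by rewrite -EFinD -EFinM opprK -mulr2n exprSr
  mulr_natl.
rewrite -leNgt => rr; have -> : r = 0%R by lra.
by rewrite mulr0 mule0 exprS mul0r.
Qed.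

Lemma measurable_eball n : measurable (@eball R n).
Proof.
have := @measurable_dot R _ _ n id id (@measurable_id _ _ _)
  (@measurable_id _ _ _) measurableT _ (measurable_itv `]-oo, 1%R]).
rewrite setTI; congr (measurable _).
by apply/seteqP; split => x;
  rewrite /eball/= in_itv/= -enorm_sqr expr_le1 ?enorm_ge0.
Qed.

Lemma leb_eball n : 0 < leb (@eball R n) < +oo.
Proof.
apply/andP; split.
  apply: (@lt_le_trans _ _ (leb (@box n (n.+1%:R^-1)))).
    by rewrite leb_box ?invr_ge0// lte_fin exprn_gt0// mulr_gt0// invr_gt0.
  apply: le_measure; rewrite ?inE;
    [exact: measurable_box|exact: measurable_eball|].
  move=> x /enorm_le_coord h; apply: le_trans (h _) _; rewrite ?invr_ge0//.
  by rewrite ler_pdivrMr// mul1r ler_nat.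
apply: (@le_lt_trans _ _ (leb (@box n 1%R))).
  apply: le_measure; rewrite ?inE;
    [exact: measurable_eball|exact: measurable_box|].
  by move=> x x1 i; apply: le_trans (coord_le_enorm _ _) x1.
by rewrite leb_box// ltry.
Qed.

Lemma integral_translate n (b : 'rV[R]_n) (f : 'rV[R]_n -> \bar R) :
  measurable_fun setT f -> (forall x, 0 <= f x) ->
  \int[leb (n:=n)]_x f (x + b)%R = \int[leb (n:=n)]_x f x.
Proof.
move=> mf f0; have := @integral_affine R n 1%R b f (oner_neq0 _) mf f0.
by rewrite normr1 invr1 expr1n mul1e => <-; apply: eq_integral => x _;
  rewrite scale1r.
Qed.

Lemma integral_scale n (t : R) (f : 'rV[R]_n -> \bar R) : (0 < t)%R ->
  measurable_fun setT f -> (forall x, 0 <= f x) ->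
  \int[leb (n:=n)]_x f x = (t ^+ n)%:E * \int[leb (n:=n)]_x f (t *: x)%R.
Proof.
move=> t0 mf f0; have := @integral_affine R n t 0%R f (lt0r_neq0 t0) mf f0.
under eq_integral do rewrite addr0.
move=> ->; rewrite muleA -EFinM gtr0_norm// exprVn mulfV ?mul1e//.
by rewrite expf_neq0// gt_eqF.
Qed.

(** Translation invariant measures are unique up to a factor. Both
    f |-> int f(x) and f |-> int f(xQ) are invariant under translations;
    integrating f(yQ + x) b(yQ) in the two orders, where b is the indicator of
    the ball, shows that they are proportional. As b(xQ) = b(x), the factor
    is 1. *)
Lemma integral_orthogonal n (Q : 'M[R]_n) (f : 'rV[R]_n -> \bar R) :
  (Q *m Q^T = 1%:M)%R ->
  measurable_fun setT f -> (forall x, 0 <= f x) ->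
  \int[leb (n:=n)]_x f (x *m Q)%R = \int[leb (n:=n)]_x f x.
Proof.
move=> QQ mf f0; have QQ' : (Q^T *m Q = 1%:M)%R by exact: mulmx1C.
pose b (x : 'rV[R]_n) : \bar R := (\1_(@eball R n) x)%:E.
have mb : measurable_fun setT b by apply: measurable_EFin_indic;
  exact: measurable_eball.
have b0 x : 0 <= b x by exact: EFin_indic_ge0.
have bE x y : enorm x = enorm y -> b x = b y.
  by move=> xy; rewrite /b !indicE; congr ((nat_of_bool _)%:R%:E);
    apply/idP/idP => /set_mem; rewrite /eball/= => h; apply/mem_set;
    rewrite /eball/= ?xy// -xy.
have bQ x : b (x *m Q)%R = b x by apply: bE; exact: enorm_frame.
have bN x : b (- x)%R = b x by apply: bE;
  rewrite -scaleN1r enormZ normrN1 mul1r.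
have mQ : measurable_fun setT (fun y : 'rV[R]_n => y *m Q)%R by
  exact: (measurable_mulmxr Q (@measurable_id _ _ _)).
have mfy y : measurable_fun setT (fun x : 'rV[R]_n => f (y *m Q + x)%R).
  by apply: (measurableT_comp mf); apply: measurable_addrV => //;
    exact: measurable_cst.
pose I := \int[leb (n:=n)]_x b x.
have IE : I = leb (@eball R n) by rewrite leb_indic//; exact: measurable_eball.
have /andP[I0 Ioo] := leb_eball n.
have mxQ : measurable_fun setT (fun p : 'rV[R]_n * 'rV[R]_n => p.2 *m Q)%R.
  exact: measurable_mulmxr measurable_snd.
have E : \int[leb (n:=n)]_x f (x *m Q)%R * I = \int[leb (n:=n)]_x f x * I.
  transitivity (\int[leb (n:=n)]_y \int[leb (n:=n)]_x
    (f (y *m Q)%R * b (x - y *m Q)%R)).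
    rewrite -ge0_integralZr//; last 2 first.
    - exact: (measurableT_comp mf mQ).
    - by rewrite IE ltW.
    apply: eq_integral => y _; rewrite ge0_integralZl//.
    - by rewrite integral_translate.
    - by apply: (measurableT_comp mb); apply: measurable_addrV => //;
      exact: measurable_cst.
  rewrite tonelli_swap; last 2 first.
  - apply: emeasurable_funM;
    first exact: (measurableT_comp mf (measurableT_comp mQ measurable_fst)).
    apply: (measurableT_comp mb); apply: measurable_addrV => //;
      apply: measurable_opprV.
    exact: (measurableT_comp mQ measurable_fst).
  - by move=> ? ?; rewrite mule_ge0.
  transitivity (\int[leb (n:=n)]_x \int[leb (n:=n)]_y
    (f (y *m Q + x)%R * b (y *m Q)%R)).
    apply: eq_integral => x _.
    rewrite -(integral_translate (- (x *m Q^T))); last 2 first.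
    - apply: emeasurable_funM; last exact: (measurableT_comp mb mQ).
      apply: (measurableT_comp mf); apply: measurable_addrV => //;
        exact: measurable_cst.
    - by move=> y; rewrite mule_ge0.
    apply: eq_integral => y _;
      rewrite mulmxDl mulNmx -(mulmxA x) QQ' mulmx1 subrK.
    by rewrite -[in LHS]bN opprB.
  rewrite tonelli_swap; last 2 first.
  - apply: emeasurable_funM; last exact: (measurableT_comp mb mxQ).
    by apply: (measurableT_comp mf); exact: measurable_addrV.
  - by move=> ? ?; rewrite mule_ge0.
  rewrite -ge0_integralZl//; last first.
    by apply: integral_ge0.
  apply: eq_integral => y _; rewrite bQ ge0_integralZr//.
    congr (_ * _); rewrite -[RHS](integral_translate (y *m Q))//.
    by apply: eq_integral => x _; rewrite addrC.
have If : I \is a fin_num by rewrite IE ge0_fin_numE// ltW.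
have : \int[leb (n:=n)]_x f (x *m Q)%R * I * (fine I)^-1%:E =
  \int[leb (n:=n)]_x f x * I * (fine I)^-1%:E by rewrite E.
rewrite -!muleA -{1 3}(fineK If) -EFinM mulfV ?mule1//.
by rewrite gt_eqF// fine_gt0// IE I0.
Qed.

End invariance.

(** * The measure ds / |s| on the line *)

Section multiplicative_haar.
Context (R : realType).
Local Open Scope ereal_scope.
Local Notation mu := (@lebesgue_measure R).

Lemma measurable_normV : measurable_fun setT (fun s : R => `|s|^-1)%R.
Proof.
rewrite (_ : (fun s : R => _) = (fun s => `|s| `^ (-1))%R); last first.
  by apply/funext => s; rewrite powR_inv1.
by apply: (measurableT_comp (@measurable_powR R (-1))).
Qed.

Lemma measurable_inv : measurable_fun setT (fun s : R => s^-1)%R.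
Proof.
rewrite (_ : (fun s : R => _) = (fun s => s * (`|s|^-1 * `|s|^-1))%R);
  last first.
  apply/funext => s; have [->|s0] := eqVneq s 0%R; first by rewrite invr0 mul0r.
  by rewrite -invfM -normrM ger0_norm -?expr2 ?sqr_ge0// expr2 invfM mulrA
    mulfV// mul1r.
by apply: measurable_funM => //; apply: measurable_funM;
  exact: measurable_normV.
Qed.

Let w (s : R) : \bar R := (`|s|^-1)%:E.
Let w0 s : 0 <= w s. Proof. by rewrite lee_fin invr_ge0. Qed.

Let mw : measurable_fun setT w.
Proof. by apply/measurable_EFinP; exact: measurable_normV. Qed.

(** The measure ds / |s| is invariant under the multiplicative group. The
    convention 0^-1 = 0 gives the origin no weight. *)
Lemma haar_scale (a : R) (g : R -> \bar R) : a != 0%R ->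
  measurable_fun setT g -> (forall x, 0 <= g x) ->
  \int[mu]_s ((`|s|^-1)%:E * g (a * s)%R) = \int[mu]_s ((`|s|^-1)%:E * g s).
Proof.
move=> a0 mg g0; pose h s := w s * g s.
have mh : measurable_fun setT h by exact: emeasurable_funM.
have h0 x : 0 <= h x by exact: mule_ge0.
have aP : (0 < `|a|)%R by rewrite normr_gt0.
have : `|a|%:E * \int[mu]_s h (a * s + 0)%R =
  `|a|%:E * ((`|a|^-1)%:E * \int[mu]_s h s).
  by rewrite lebesgue_affine.
rewrite muleA -EFinM mulfV ?gt_eqF// mul1e => <-.
rewrite -ge0_integralZl//.
- apply: eq_integral => s _;
  rewrite /h /w addr0 muleA -EFinM normrM invfM mulrA mulfV ?gt_eqF//.
  by rewrite mul1r.
- apply: (measurableT_comp mh); apply: measurable_funD;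
  last exact: measurable_cst.
  by apply: measurable_funM => //; exact: measurable_cst.
Qed.

(** An invariant measure on a commutative group is invariant under inversion.
    With b the indicator of [1, 2], invariance under multiplication turns
    int int g(y) b(yx) into int int g(y / x) b(y), so that
    int b * int g = int b * int g(1 / s), and int b lies in ]0, +oo[. *)
Lemma haar_inv (g : R -> \bar R) : measurable_fun setT g ->
  (forall x, 0 <= g x) ->
  \int[mu]_s ((`|s|^-1)%:E * g (s^-1)%R) = \int[mu]_s ((`|s|^-1)%:E * g s).
Proof.
move=> mg g0.
pose b (s : R) : \bar R := (\1_(`[1%R, 2%R]%classic) s)%:E.
have mb : measurable_fun setT b by exact: measurable_EFin_indic.
have b0 s : 0 <= b s by exact: EFin_indic_ge0.
pose al := \int[mu]_s (w s * b s).
have mwb : measurable_fun setT (fun s : R => w s * b s) by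
  exact: emeasurable_funM.
have b1 : \int[mu]_s b s = 1.
  rewrite integral_indic//= setIT lebesgue_measure_itv/= lte_fin ltr1n -EFinB.
  by congr (_%:E); ring.
have al_gt0 : 0 < al.
  apply: (@lt_le_trans _ _ ((2^-1)%:E * \int[mu]_s b s));
    first by rewrite b1 mule1.
  rewrite -ge0_integralZl//; apply: ge0_le_integral => //.
  - by move=> s _; rewrite mule_ge0.
  - by apply: emeasurable_funM => //; exact: measurable_cst.
  - move=> s _; rewrite /b indicE; have [|_] := boolP (s \in _);
    last by rewrite !mule0.
    rewrite inE/= in_itv/= => /andP[s1 s2];
      rewrite !mule1 lee_fin lef_pV2 ?posrE ?normr_gt0//; last first.
      by rewrite gt_eqF// (lt_le_trans _ s1).
    by rewrite ger0_norm// (le_trans _ s1).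
have al_fin : al \is a fin_num.
  rewrite ge0_fin_numE ?ltW//; apply: (@le_lt_trans _ _ (\int[mu]_s b s));
    last by rewrite b1 ltry.
  apply: ge0_le_integral => //; first by move=> s _; rewrite mule_ge0.
  move=> s _; rewrite /b indicE; have [|_] := boolP (s \in _);
    last by rewrite !mule0.
  rewrite inE/= in_itv/= => /andP[s1 s2]; rewrite !mule1 lee_fin.
  rewrite invf_le1 ?normr_gt0//; last by rewrite gt_eqF// (lt_le_trans _ s1).
  by rewrite ger0_norm// (le_trans _ s1).
have mgV : measurable_fun setT (fun s : R => g (s^-1)%R) by
  exact: (measurableT_comp mg measurable_inv).
have E : al * \int[mu]_s (w s * g s) = al * \int[mu]_s (w s * g (s^-1)%R).
  have mwg : measurable_fun setT (fun s : R => w s * g s) by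
    exact: emeasurable_funM.
  have mwgV : measurable_fun setT (fun s : R => w s * g s^-1%R) by
    exact: emeasurable_funM.
  transitivity (\int[mu]_y \int[mu]_x (w y * g y * (w x * b (y * x)%R))).
    rewrite muleC -ge0_integralZr//; last 2 first.
    - by move=> s _; rewrite mule_ge0.
    - exact: ltW.
    apply: eq_integral => y _; rewrite ge0_integralZl//; last 3 first.
    - apply: emeasurable_funM => //; apply: (measurableT_comp mb).
      by apply: measurable_funM => //; exact: measurable_cst.
    - by move=> s _; rewrite mule_ge0.
    - by rewrite mule_ge0.
    have [->|y0] := eqVneq y 0%R; first by rewrite /w normr0 invr0 !mul0e.
    by rewrite haar_scale.
  rewrite tonelli_swap; last 2 first.
  - apply: emeasurable_funM; first exact: (measurableT_comp mwg).
    apply: emeasurable_funM; first exact: (measurableT_comp mw).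
    by apply: (measurableT_comp mb); exact: measurable_funM.
  - by move=> x y; rewrite !mule_ge0.
  transitivity (\int[mu]_x \int[mu]_y (w y * (w x * (g (y * x^-1)%R * b y)))).
    apply: eq_integral => x _.
    have [->|x0] := eqVneq x 0%R.
      rewrite /w normr0 invr0; apply: eq_integral => y _;
        by rewrite !mul0e !mule0.
    transitivity (\int[mu]_y (w y * (fun z : R => w x * (g (z * x^-1)%R * b z))
      (x * y)%R)).
      apply: eq_integral => y _; rewrite -muleA; congr (_ * _).
      by rewrite [RHS]muleCA (mulrC x y) mulfK.
    rewrite (@haar_scale x (fun z : R => w x * (g (z * x^-1)%R * b z)))//.
    - apply: measurable_funeM; apply: emeasurable_funM => //.
      by apply: (measurableT_comp mg); apply: measurable_funM => //;
        exact: measurable_cst.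
    - by move=> y; rewrite !mule_ge0.
  rewrite tonelli_swap; last 2 first.
  - apply: emeasurable_funM; first exact: (measurableT_comp mw).
    apply: emeasurable_funM; first exact: (measurableT_comp mw).
    apply: emeasurable_funM; last exact: (measurableT_comp mb).
    by apply: (measurableT_comp mg); apply: measurable_funM => //;
      exact: (measurableT_comp measurable_inv).
  - by move=> x y; rewrite !mule_ge0.
  rewrite [RHS]muleC -ge0_integralZl//; last 2 first.
  - by move=> s _; rewrite mule_ge0.
  - by apply: integral_ge0 => s _; rewrite mule_ge0.
  apply: eq_integral => y _.
  transitivity (\int[mu]_x (w y * b y * (w x * g (y * x^-1)%R))).
    apply: eq_integral => x _.
    by rewrite [g _ * b y]muleC (muleCA (w x)) [LHS]muleA.
  rewrite ge0_integralZl//; last 3 first.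
  - apply: emeasurable_funM => //; apply: (measurableT_comp mg).
    by apply: measurable_funM; [exact: measurable_cst|exact: measurable_inv].
  - by move=> x _; rewrite mule_ge0.
  - by rewrite mule_ge0.
  rewrite muleC; have [->|y0] := eqVneq y 0%R;
    first by rewrite /w normr0 invr0 !mul0e !mule0.
  congr (_ * _); rewrite -(@haar_scale y^-1 (fun s : R => g (s^-1)%R))
    ?invr_eq0//.
  by apply: eq_integral => x _; rewrite invfM invrK.
have : (fine al)^-1%:E * (al * \int[mu]_s (w s * g s)) =
  (fine al)^-1%:E * (al * \int[mu]_s (w s * g (s^-1)%R)) by rewrite E.
rewrite !muleA -{2 4}(fineK al_fin) -EFinM mulVf ?mul1e//.
by rewrite gt_eqF// fine_gt0// al_gt0 -ge0_fin_numE// ltW.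
Qed.

Lemma haar_reflect (c : R) (F G : R -> \bar R) : c != 0%R ->
  measurable_fun setT F -> measurable_fun setT G -> (forall x, 0 <= F x) ->
    (forall x, 0 <= G x) ->
  \int[mu]_s ((`|s|^-1)%:E * (F s * G (c / s)%R)) =
    \int[mu]_s ((`|s|^-1)%:E * (F (c / s)%R * G s)).
Proof.
move=> c0 mF mG F0 G0.
have mc (a : R) : measurable_fun setT (fun s : R => a * s)%R.
  by apply: measurable_funM => //; exact: measurable_cst.
have mcV (a : R) : measurable_fun setT (fun s : R => a / s)%R.
  by apply: measurable_funM => //; exact: measurable_inv.
rewrite -(@haar_inv (fun s : R => F s * G (c / s)%R)); last 2 first.
- by apply: emeasurable_funM => //; exact: measurableT_comp.
- by move=> s; rewrite mule_ge0.
rewrite -(@haar_scale c (fun s : R => F (c / s)%R * G s))//; last 2 first.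
- by apply: emeasurable_funM => //; exact: measurableT_comp.
- by move=> s; rewrite mule_ge0.
by apply: eq_integral => s _; rewrite invrK invfM mulrA mulfV// mul1r.
Qed.

(** The hyperplane orthogonal to a is negligible: every line parallel to the
    first axis meets it in a single point. *)
Lemma integral_eq_off_hyperplane n (a : 'rV[R]_n.+1)
  (f g : 'rV[R]_n.+1 -> \bar R) :
  a ord0 ord0 != 0%R ->
  measurable_fun setT f -> measurable_fun setT g -> (forall x, 0 <= f x) ->
    (forall x, 0 <= g x) ->
  (forall x, dot a x != 0%R -> f x = g x) ->
  \int[leb (n:=n.+1)]_x f x = \int[leb (n:=n.+1)]_x g x.
Proof.
move=> a0 mf mg f0 g0 fg; rewrite !integral_rowcons2//.
apply: eq_integral => x _.
have mr : measurable_fun setT (fun s : measurableTypeR R => rowcons s x).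
  by apply: measurable_rowcons => //; exact: measurable_cst.
apply: ge0_ae_eq_integral => //;
  [exact: (measurableT_comp mf mr)|exact: (measurableT_comp mg mr)|].
exists [set - dot (rowtail a) x / a ord0 ord0]%R; split => //.
  exact: lebesgue_measure_set1.
move=> s /= /not_implyP[_ h]; apply/eqP;
  rewrite eq_sym -(can_eq (mulfK a0)) divfK//.
apply/negPn/negP => h'; apply: h; apply: fg;
  rewrite -{1}(rowtailK a) dot_rowcons.
by apply: contra h' => /eqP h'; apply/eqP; rewrite -[LHS]add0r -h'; ring.
Qed.

End multiplicative_haar.

(** * The Radon transform in graph coordinates *)

Section radon.
Context (R : realType).
Local Open Scope ereal_scope.
Local Notation mu := (@lebesgue_measure R).

(** The point of the hyperplane orthogonal to x whose last coordinates are y. *)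
Definition hyperplane_graph n (x : 'rV[R]_n.+1) (y : 'rV[R]_n) : 'rV[R]_n.+1 :=
  rowcons (- dot (rowtail x) y / x ord0 ord0)%R y.

Lemma measurable_hyperplane_graph d (T : measurableType d) n
  (f : T -> 'rV[R]_n.+1) (g : T -> 'rV[R]_n) :
  measurable_fun setT f -> measurable_fun setT g ->
    measurable_fun setT (fun x => hyperplane_graph (f x) (g x)).
Proof.
move=> mf mg; apply: measurable_rowcons => //; apply: measurable_funM.
  under eq_fun do rewrite -mulN1r; apply: measurable_funM;
    first exact: measurable_cst.
  by apply: measurable_dot => //;
    exact: (measurableT_comp (@measurable_rowtail R n) mf).
apply: (measurableT_comp (@measurable_inv R)).
exact: (measurableT_comp (measurable_coord ord0) mf).
Qed.

(** For the indicator of A this is |A cap x^perp| / |x|, see [radon_hvol]. The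
    points with vanishing first coordinate get the value 0; they are
    negligible, and in exchange the formula is measurable in x. *)
Definition radon n (f : 'rV[R]_n.+1 -> \bar R) (x : 'rV[R]_n.+1) : \bar R :=
  (`|x ord0 ord0|^-1)%:E * \int[leb (n:=n)]_y f (hyperplane_graph x y).

Lemma radon_ge0 n (f : 'rV[R]_n.+1 -> \bar R) x : (forall x, 0 <= f x) ->
  0 <= radon f x.
Proof.
by move=> f0; apply: mule_ge0; rewrite ?lee_fin ?invr_ge0//;
  exact: integral_ge0.
Qed.

Lemma measurable_radon n (f : 'rV[R]_n.+1 -> \bar R) :
  measurable_fun setT f -> (forall x, 0 <= f x) ->
    measurable_fun setT (radon f).
Proof.
move=> mf f0; apply: emeasurable_funM.
  apply/measurable_EFinP; apply: (measurableT_comp (@measurable_normV R)).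
  exact: measurable_coord.
apply: (measurable_fun_fubini_tonelli_F
  (fun p : 'rV[R]_n.+1 * 'rV[R]_n => f (hyperplane_graph p.1 p.2))) => //.
by apply: (measurableT_comp mf); exact: measurable_hyperplane_graph.
Qed.

(** The last coordinates of two orthogonal points are x and y; the first
    coordinates are s and, by orthogonality, - <x, y> / s. *)
Let radon_kernel n (f g : 'rV[R]_n.+1 -> \bar R) (x y : 'rV[R]_n) (s : R) :
  \bar R :=
  (`|s|^-1)%:E * (g (rowcons s x) * f (rowcons (- dot x y / s)%R y)).

Let measurable_radon_kernel n (f g : 'rV[R]_n.+1 -> \bar R) :
  measurable_fun setT f -> measurable_fun setT g ->
  measurable_fun setT (fun p : ('rV[R]_n * 'rV[R]_n) * R => radon_kernel f g
    p.1.1 p.1.2 p.2).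
Proof.
move=> mf mg.
have m11 : measurable_fun setT (fun p : ('rV[R]_n * 'rV[R]_n) * R => p.1.1).
  by exact: (measurableT_comp measurable_fst measurable_fst).
have m12 : measurable_fun setT (fun p : ('rV[R]_n * 'rV[R]_n) * R => p.1.2).
  by exact: (measurableT_comp measurable_snd measurable_fst).
apply: emeasurable_funM.
  by apply/measurable_EFinP; apply: (measurableT_comp (@measurable_normV R)).
apply: emeasurable_funM.
  by apply: (measurableT_comp mg); exact: measurable_rowcons.
apply: (measurableT_comp mf); apply: measurable_rowcons => //.
apply: measurable_funM; last exact: (measurableT_comp (@measurable_inv R)).
under eq_fun do rewrite -mulN1r; apply: measurable_funM;
  first exact: measurable_cst.
exact: measurable_dot.
Qed.

Lemma integral_radonE n (f g : 'rV[R]_n.+1 -> \bar R) : measurable_fun setT f ->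
  measurable_fun setT g ->
  (forall x, 0 <= f x) -> (forall x, 0 <= g x) ->
  \int[leb (n:=n.+1)]_x (g x * radon f x) =
  \int[leb (n:=n)]_x \int[leb (n:=n)]_y \int[mu]_s radon_kernel f g x y s.
Proof.
move=> mf mg f0 g0; rewrite integral_rowcons2; last 2 first.
- by apply: emeasurable_funM => //; exact: measurable_radon.
- by move=> x; rewrite mule_ge0// radon_ge0.
apply: eq_integral => x _; rewrite -tonelli_swap; last 2 first.
- have mk := measurable_radon_kernel mf mg.
  have mp : measurable_fun setT (fun p : R * 'rV[R]_n => ((x, p.2), p.1)).
    apply: measurable_fun_pair => //; apply: measurable_fun_pair => //.
  exact: (measurableT_comp mk mp).
- by move=> s y; rewrite /radon_kernel !mule_ge0// lee_fin invr_ge0.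
apply: eq_integral => s _; rewrite /radon rowcons0 muleCA.
have mfl : measurable_fun setT (fun y => f (hyperplane_graph (rowcons s x) y)).
  by apply: (measurableT_comp mf); apply: measurable_hyperplane_graph => //;
    exact: measurable_cst.
have -> : (fun y => radon_kernel f g x y s) =
  (fun y => (`|s|^-1)%:E * (g (rowcons s x) * f
  (hyperplane_graph (rowcons s x) y))).
  by apply/funext => y; rewrite /radon_kernel /hyperplane_graph rowcons0
    rowconsK.
rewrite ge0_integralZl//; last 2 first.
- by apply: emeasurable_funM => //; exact: measurable_cst.
- by move=> y _; rewrite mule_ge0.
by rewrite ge0_integralZl.
Qed.

(** Exchanging f and g is the substitution s -> - <x, y> / s in
    [radon_kernel], legitimate when <x, y> <> 0. In dimension at least 2 the
    vectors x and y have a coordinate, and almost all pairs are of this kind. *)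
Lemma radon_symm n (f g : 'rV[R]_n.+2 -> \bar R) : measurable_fun setT f ->
  measurable_fun setT g ->
  (forall x, 0 <= f x) -> (forall x, 0 <= g x) ->
  \int[leb (n:=n.+2)]_x (g x * radon f x) =
    \int[leb (n:=n.+2)]_x (f x * radon g x).
Proof.
move=> mf mg f0 g0; rewrite (integral_radonE mf mg f0 g0)
  (integral_radonE mg mf g0 f0).
have k0 (h k : 'rV[R]_n.+2 -> \bar R) x y s : (forall x, 0 <= h x) ->
  (forall x, 0 <= k x) -> 0 <= radon_kernel h k x y s.
  by move=> h0 hk; rewrite /radon_kernel !mule_ge0// lee_fin invr_ge0.
have mk (h k : 'rV[R]_n.+2 -> \bar R) : measurable_fun setT h ->
  measurable_fun setT k ->
    (forall x, 0 <= h x) -> (forall x, 0 <= k x) ->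
    measurable_fun setT (fun p : 'rV[R]_n.+1 * 'rV[R]_n.+1 => \int[mu]_s
      radon_kernel h k p.1 p.2 s).
  move=> mh mk h0 hk.
  have k0' q : 0 <= radon_kernel h k q.1.1 q.1.2 q.2 by exact: k0.
  exact: (measurable_fun_fubini_tonelli_F (m2 := mu) _
    (measurable_radon_kernel mh mk) k0').
have i0 (h k : 'rV[R]_n.+2 -> \bar R) x y : (forall x, 0 <= h x) ->
  (forall x, 0 <= k x) -> 0 <= \int[mu]_s radon_kernel h k x y s.
  by move=> h0 hk; apply: integral_ge0 => s _; exact: k0.
have mx x : measurable_fun setT
  (fun y : 'rV[R]_n.+1 => (x, y) : 'rV[R]_n.+1 * 'rV[R]_n.+1).
  by apply: measurable_fun_pair => //; exact: measurable_cst.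
have my y : measurable_fun setT
  (fun x : 'rV[R]_n.+1 => (x, y) : 'rV[R]_n.+1 * 'rV[R]_n.+1).
  by apply: measurable_fun_pair => //; exact: measurable_cst.
rewrite [RHS]tonelli_swap; last 2 first.
- exact: mk.
- by move=> x y; exact: i0.
apply: (@integral_eq_off_hyperplane _ _ (basis0 R n)).
- exact: basis0_neq0.
- exact: (measurable_fun_fubini_tonelli_F
  (fun p => \int[mu]_s radon_kernel f g p.1 p.2 s) (mk _ _ mf mg f0 g0)
  (fun p => i0 _ _ p.1 p.2 f0 g0)).
- exact: (measurable_fun_fubini_tonelli_G
  (fun p => \int[mu]_s radon_kernel g f p.1 p.2 s) (mk _ _ mg mf g0 f0)
  (fun p => i0 _ _ p.1 p.2 g0 f0)).
- by move=> x; apply: integral_ge0 => y _; exact: i0.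
- by move=> x; apply: integral_ge0 => y _; exact: i0.
move=> x; rewrite dot_basis0 => x0.
apply: (@integral_eq_off_hyperplane _ _ x) => //.
- exact: (measurableT_comp (mk _ _ mf mg f0 g0) (mx x)).
- exact: (measurableT_comp (mk _ _ mg mf g0 f0) (my x)).
- by move=> y; exact: i0.
- by move=> y; exact: i0.
move=> y xy; rewrite /radon_kernel.
have yx : dot y x = dot x y by apply: eq_bigr => i _; rewrite mulrC.
rewrite (@haar_reflect _ (- dot x y) (fun s => g (rowcons s x))
  (fun s => f (rowcons s y)))//.
- by apply: eq_integral => s _; rewrite yx [f _ * _]muleC.
- by rewrite oppr_eq0.
- by apply: (measurableT_comp mg); apply: measurable_rowcons => //;
  exact: measurable_cst.
- by apply: (measurableT_comp mf); apply: measurable_rowcons => //;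
  exact: measurable_cst.
Qed.

(** Let p be the projection onto the hyperplane orthogonal to xi along the first
    axis, and let F(x) be f(p x) if 0 <= <x, xi> <= 1 and 0 otherwise; compute
    int F twice. In the orthonormal basis formed by xi and the rows of U, the
    slice at each height contributes int f(zU). In the standard basis, the
    line above y contributes the value of f at the point of the graph, times
    the length 1 / |xi_1|. This replaces a Jacobian determinant. *)
Lemma integral_frame n (xi : 'rV[R]_n.+1) (U : 'M[R]_(n, n.+1))
  (f : 'rV[R]_n.+1 -> \bar R) :
  measurable_fun setT f -> (forall x, 0 <= f x) ->
  enorm xi = 1%R -> xi ord0 ord0 != 0%R -> is_frame xi U ->
  \int[leb (n:=n)]_z f (z *m U)%R = radon f xi.
Proof.
move=> mf f0 xi1 xi0 [UU Uxi].
have xixi : dot xi xi = 1%R by rewrite -enorm_sqr xi1 expr1n.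
pose Q : 'M[R]_n.+1 := (\matrix_(i, j) if unlift ord0 i is Some k then U k j
  else xi ord0 j)%R.
have QE s z : (rowcons s z *m Q = s *: xi + z *m U)%R.
  apply/rowP => j; rewrite !mxE big_ord_recl rowcons0 mxE unlift_none;
    congr (_ + _)%R.
  by apply: eq_bigr => i _; rewrite rowconsS mxE liftK.
have Ud k : (\sum_j U k j * xi ord0 j = 0)%R.
  have /matrixP/(_ k ord0) := Uxi; rewrite !mxE => h; rewrite -[RHS]h.
  by apply: eq_bigr => j _; rewrite mxE.
have QQ : (Q *m Q^T = 1%:M)%R.
  apply/matrixP => i j; rewrite !mxE; under eq_bigr do rewrite !mxE.
  have [i' ->|->] := unliftP ord0 i; have [j' ->|->] := unliftP ord0 j.
  - move/matrixP: UU => /(_ i' j'); rewrite !mxE (inj_eq lift_inj) => <-.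
    by apply: eq_bigr => k _; rewrite mxE.
  - by rewrite Ud eq_sym (negbTE (neq_lift _ _)).
  - by rewrite (negbTE (neq_lift _ _)) -[RHS](Ud j'); apply: eq_bigr => k _;
    rewrite mulrC.
  - by rewrite eqxx.
have zUxi z : dot (z *m U)%R xi = 0%R.
  by apply: frame_hyperplane; split.
pose e := basis0 R n.
pose c : R := xi ord0 ord0.
pose F (x : 'rV[R]_n.+1) : \bar R := (\1_(`[0%R, 1%R]%classic) (dot x xi) :
  R)%:E * f (x - (dot x xi / c) *: e)%R.
have mD : measurable_fun setT (fun x : 'rV[R]_n.+1 => dot x xi).
  by apply: measurable_dot => //; exact: measurable_cst.
have m01 : measurable_fun setT
  (fun s : R => (\1_(`[0%R, 1%R]%classic) s : R)%:E) by
  exact: measurable_EFin_indic.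
have mF : measurable_fun setT F.
  apply: emeasurable_funM; first exact: (measurableT_comp m01 mD).
  apply: (measurableT_comp mf); apply: measurable_addrV => //;
    apply: measurable_opprV.
  apply: measurable_scalerV; last exact: measurable_cst.
  by apply: measurable_funM => //; exact: measurable_cst.
have F0 x : 0 <= F x by rewrite mule_ge0// EFin_indic_ge0.
have lin s t (x y : 'rV[R]_n.+1) :
  (dot (s *: x + t *: y) xi = s * dot x xi + t * dot y xi)%R.
  by rewrite /dot !mulr_sumr -big_split; apply: eq_bigr => i _; rewrite !mxE/=;
    ring.
have int01 : \int[mu]_s (\1_(`[0%R, 1%R]%classic) s : R)%:E = 1.
  by rewrite integral_indic//= setIT lebesgue_measure_itv/= lte_fin ltr01 -EFinB
    subr0.
have mfU : measurable_fun setT (fun z : 'rV[R]_n => f (z *m U)%R).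
  by apply: (measurableT_comp mf);
    exact: (measurable_mulmxr U (@measurable_id _ _ _)).
transitivity (\int[leb (n:=n.+1)]_x F x).
  rewrite -(integral_orthogonal QQ)// integral_rowcons//; last first.
    by apply: (measurableT_comp mF);
      exact: (measurable_mulmxr Q (@measurable_id _ _ _)).
  transitivity (\int[mu]_s ((\1_(`[0%R, 1%R]%classic) s : R)%:E *
    \int[leb (n:=n)]_z f (z *m U)%R)).
    by rewrite ge0_integralZr// ?int01 ?mul1e// integral_ge0.
  apply: eq_integral => s _.
  (* p (s xi + z U) = z U + s v, and v is a combination of the rows of U because
     it is orthogonal to xi. *)
  pose v := (xi - c^-1 *: e)%R.
  have vxi : dot v xi = 0%R.
    have := lin 1%R (- c^-1)%R xi e; rewrite scale1r scaleNr -/v => ->.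
    by rewrite xixi dot_basis0 mulr1 mulNr mulVf// subrr.
  have vE : v = (v *m U^T *m U)%R.
    have QtQ : (Q^T *m Q = 1%:M)%R by exact: mulmx1C.
    rewrite -[LHS]mulmx1 -QtQ mulmxA.
    have -> : (v *m Q^T = rowcons 0 (v *m U^T))%R.
      apply/rowP => i; rewrite mxE; have [k ->|->] := unliftP ord0 i.
        rewrite rowconsS mxE; apply: eq_bigr => j _; by rewrite !mxE liftK.
      by rewrite rowcons0 -[RHS]vxi; apply: eq_bigr => j _;
        rewrite !mxE unlift_none.
    by rewrite QE scale0r add0r.
  have FE z : F (rowcons s z *m Q)%R = (\1_(`[0%R, 1%R]%classic) s :
    R)%:E * f ((z + s *: (v *m U^T)) *m U)%R.
    have d : dot (s *: xi + z *m U)%R xi = s.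
      by have := lin s 1%R xi (z *m U)%R; rewrite scale1r => ->;
        rewrite xixi zUxi mulr0 addr0 mulr1.
    rewrite /F QE d; congr (_ * f _).
    rewrite mulmxDl -scalemxAl -vE /v scalerBr scalerA addrA.
    by rewrite (addrC (s *: xi)).
  rewrite [RHS](eq_integral (fun z : 'rV[R]_n => (\1_(`[0%R, 1%R]%classic)
    s : R)%:E * f ((z + s *: (v *m U^T)) *m U)%R)); last by move=> z _;
    exact: FE.
  rewrite [RHS]ge0_integralZl//.
  - congr (_ * _).
    by rewrite (@integral_translate _ _ (s *: (v *m U^T))%R
      (fun z : 'rV[R]_n => f (z *m U)%R)).
  - apply: (measurableT_comp mfU); apply: measurable_addrV => //;
    exact: measurable_cst.
rewrite integral_rowcons2// /radon -ge0_integralZl//; last first.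
  by apply: (measurableT_comp mf); apply: measurable_hyperplane_graph => //;
    exact: measurable_cst.
apply: eq_integral => y _.
have dE t : dot (rowcons t y) xi = (c * t + dot (rowtail xi) y)%R.
  rewrite -{1}(rowtailK xi) dot_rowcons mulrC; congr (_ + _)%R.
  by apply: eq_bigr => i _; rewrite mulrC.
have FE t : F (rowcons t y) =
  f (hyperplane_graph xi y) * (\1_(`[0%R, 1%R]%classic)
  (c * t + dot (rowtail xi) y)%R : R)%:E.
  rewrite /F muleC dE; congr (f _ * _).
  have sub (x : 'rV[R]_n.+1) d i :
    ((x - d *: e) ord0 i = x ord0 i - d * e ord0 i)%R by rewrite !mxE.
  apply/rowP => i; rewrite sub /hyperplane_graph; have [j ->|->] :=
    unliftP ord0 i.
    by rewrite !rowconsS mxE eqxx/= mulr0 subr0.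
  by rewrite !rowcons0 mxE !eqxx mulr1 -/c; field.
transitivity (\int[mu]_t (f (hyperplane_graph xi y) * (\1_(`[0%R, 1%R]%classic)
  (c * t + dot (rowtail xi) y)%R : R)%:E)).
  by apply: eq_integral => t _; exact: FE.
rewrite ge0_integralZl//; last first.
  apply: (measurableT_comp m01); apply: measurable_funD;
    last exact: measurable_cst.
  by apply: measurable_funM => //; exact: measurable_cst.
rewrite (@lebesgue_affine _ c _
  (fun s : R => (\1_(`[0%R, 1%R]%classic) s : R)%:E))// ?int01 ?mule1 1?muleC//.
Qed.

End radon.

(** * Star bodies and their gauges *)

Section star_body.
Context (R : realType) (n : nat).
Implicit Types (K : set 'rV[R]_n) (u x : 'rV[R]_n).

(** The largest s <= b with s u in K: the segment beyond it is outside of K. *)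
Lemma boundary_exit K u (a b : R) : closed K -> a < b -> K (a *: u) ->
  ~ K (b *: u) ->
  exists2 s, a <= s < b & boundary K (s *: u).
Proof.
move=> cK ab Ka Kb.
pose A : set R := [set s | s <= b /\ K (s *: u)].
have A0 : A !=set0 by exists a; split => //; exact: ltW.
have Ab : has_ubound A by exists b => s [].
have cu : continuous (fun s : R => s *: u) by exact: scalel_continuous.
have cA : closed A.
  apply: closedI; first exact: closed_le.
  by move/continuous_closedP: cu; exact.
have [sb Ks] : A (sup A) by rewrite [X in X (sup _)](closure_id A).1//;
  exact: closure_sup.
have {}sb : sup A < b.
  by rewrite lt_neqAle sb andbT; apply/eqP => sE; apply: Kb; rewrite -sE.
exists (sup A).
  by rewrite sb andbT; apply: ub_le_sup => //; split => //; exact: ltW.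
split; first exact: subset_closure.
move=> Ki.
have : nbhs (sup A) ((fun s : R => s *: u) @^-1` K) by apply: cu.
move=> /nbhs_ballP[e /= e0 he].
pose s := sup A + Num.min (e / 2) (b - sup A).
have m0 : 0 < Num.min (e / 2) (b - sup A) by rewrite lt_min divr_gt0//=
  subr_gt0.
have : s <= sup A.
  apply: ub_le_sup => //; split; first by rewrite /s -lerBrDl ge_min lexx orbT.
  apply: he; rewrite /ball/= /s opprD addrA subrr add0r normrN gtr0_norm//.
  by rewrite gt_min ltr_pdivrMr// ltr_pMr// ltr1n.
by rewrite /s leNgt ltrDl m0.
Qed.

Lemma boundary_enter K u (a b : R) : closed K -> a < b -> ~ K (a *: u) ->
  K (b *: u) ->
  exists2 s, a < s <= b & boundary K (s *: u).
Proof.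
move=> cK ab Ka Kb.
have [|||s /andP[s1 s2] sB] := @boundary_exit K (- u) (- b) (- a) cK.
- by rewrite ltrN2.
- by rewrite scaleNr scalerN opprK.
- by rewrite scaleNr scalerN opprK.
exists (- s); first by rewrite ltrNr s2 lerNl s1.
by rewrite scaleNr -scalerN.
Qed.

Lemma star_body_ball K : star_body K -> exists2 r :
  R, 0 < r & forall x, enorm x <= r -> K x.
Proof.
move=> [_ _ _ K0 _]; have /nbhs_ballP[e /= e0 he] : nbhs (0 : 'rV[R]_n) K by [].
exists (e / 2); first by rewrite divr_gt0.
move=> x xe; apply: he; split => // i j;
  rewrite (ord1 i) mxE /ball/= sub0r normrN.
apply: le_lt_trans (coord_le_enorm _ _) _; apply: le_lt_trans xe _.
by rewrite ltr_pdivrMr// ltr_pMr// ltr1n.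
Qed.

Lemma star_body_bounded K : star_body K -> exists2 C :
  R, 0 < C & forall x, K x -> enorm x <= C.
Proof.
move=> [_ [M [_ bK]] _ _ _].
pose c := Num.max (M + 1) 1.
exists (n.+1%:R * c); first by rewrite mulr_gt0// lt_max ltr01 orbT.
have c0 : 0 <= c by rewrite le_max ler01 orbT.
move=> x Kx; apply: (@le_trans _ _ (n%:R * c));
  last by rewrite ler_wpM2r// ler_nat.
apply: enorm_le_coord => // i; apply: (@le_trans _ _ `|x|); last first.
  by apply: (bK c) => //; rewrite /c lt_max ltrDl ltr01.
by rewrite [leRHS]/Num.Def.normr /= mx_normrE; apply/bigmax_geP; right => /=;
  exists (ord0, i).
Qed.

(** If t x were outside of K, the line through x would meet the boundary in
    three points: on leaving K between 0 and t x, on entering it again between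
    t x and x, and on leaving it in the direction of - x. *)
Lemma star_body_shape K x (t : R) : star_body K -> K x -> 0 <= t <= 1 ->
  K (t *: x).
Proof.
move=> sK Kx /andP[t0 t1].
have [cK _ bK K0 _] := sK.
have K00 : K 0 by exact: interior_subset.
have [->|x0] := eqVneq x 0; first by rewrite scaler0.
apply: contrapT => Kt.
have t0' : 0 < t by rewrite lt_neqAle t0 andbT; apply/eqP => tE; apply: Kt;
  rewrite -tE scale0r.
have t1' : t < 1 by rewrite lt_neqAle t1 andbT; apply/eqP => tE; apply: Kt;
  rewrite tE scale1r.
have [|s1 /andP[s1a s1b] Bs1] := @boundary_exit K x 0 t cK t0' _ Kt;
  first by rewrite scale0r.
have [|s2 /andP[s2a s2b] Bs2] := @boundary_enter K x t 1 cK t1' Kt;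
  first by rewrite scale1r.
have [C C0 KC] := star_body_bounded sK.
have ex0 := enorm_gt0 x0.
pose b := (C + 1) / enorm x.
have b0 : 0 < b by rewrite divr_gt0// addr_gt0.
have [||s3 /andP[s3a s3b] Bs3] := @boundary_exit K (- x) 0 b cK b0.
- by rewrite scale0r.
- move=> /KC; rewrite enormZ -scaleN1r enormZ normrN1 mul1r gtr0_norm//
  divfK ?gt_eqF//.
  by rewrite leNgt ltrDl ltr01.
have nz s : boundary K (s *: x) -> s != 0.
  by move=> [_ h]; apply/eqP => s0; apply: h; rewrite s0 scale0r.
have s10 := nz _ Bs1; have s20 := nz _ Bs2.
have s30 : s3 != 0 by rewrite -oppr_eq0; apply: nz; rewrite scaleNr -scalerN.
pose S := (range (fun t : R => t *: x) `&` boundary K `\ 0).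
have inS s : boundary K (s *: x) -> S (s *: x).
  move=> Bs; split; first by split => //; exists s.
  by move=> /= /eqP; rewrite scaler_eq0 (negbTE x0) orbF; apply/negP; exact: nz.
have := bK x x0; rewrite -/S => /card_eqPle[/pcard_leP[f] _].
have fI s : boundary K (s *: x) -> (f (s *: x) < 2)%N.
  by move=> Bs; have := @funS _ _ _ _ f _ (inS _ Bs).
have fE s s' : boundary K (s *: x) -> boundary K (s' *: x) -> s != s' ->
  f (s *: x) != f (s' *: x).
  move=> Bs Bs'; apply: contra => /eqP ff; apply/eqP.
  have /(_ ff) := @inj _ _ _ f _ _ (mem_set (inS _ Bs)) (mem_set (inS _ Bs')).
  by move=> /eqP; rewrite -subr_eq0 -scalerBl scaler_eq0 (negbTE x0) orbF
    subr_eq0 => /eqP.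
have B3 : boundary K (- s3 *: x) by rewrite scaleNr -scalerN.
have s1p : 0 < s1 by rewrite lt_neqAle eq_sym s10.
have s2p : 0 < s2 by exact: lt_trans s2a.
have s3p : 0 < s3 by rewrite lt_neqAle eq_sym s30.
have d12 : s1 != s2 by rewrite lt_eqF// (lt_trans s1b).
have d13 : s1 != - s3 by rewrite gt_eqF// (lt_trans _ s1p)// oppr_lt0.
have d23 : s2 != - s3 by rewrite gt_eqF// (lt_trans _ s2p)// oppr_lt0.
have := fE _ _ Bs1 Bs2 d12; have := fE _ _ Bs1 B3 d13;
  have := fE _ _ Bs2 B3 d23.
have := fI _ Bs1; have := fI _ Bs2; have := fI _ B3.
by case: (f _) => [|[|?]]//; case: (f _) => [|[|?]]//; case: (f _) => [|[|?]].
Qed.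

Local Notation gauge := (@minkowski_functional R n).

Let gset K x : set R := [set a : R | 0 <= a /\ [set a *: y | y in K] x].
Let gset_lb K x : has_lbound (gset K x).
Proof. by exists 0 => a []. Qed.

Let gset_ne K x : star_body K -> gset K x !=set0.
Proof.
move=> /star_body_ball[r r0 rK]; exists (enorm x / r); split;
  first by rewrite divr_ge0 ?enorm_ge0// ltW.
have [x0|x0] := eqVneq (enorm x) 0.
  exists 0; first by apply: rK; rewrite enorm0 ltW.
  by rewrite scaler0 (enorm_eq0 x0).
exists ((r / enorm x) *: x); last first.
  by rewrite scalerA mulrA divfK ?gt_eqF// mulfV// scale1r.
have e0 : 0 <= r / enorm x by rewrite divr_ge0 ?enorm_ge0// ltW.
by apply: rK; rewrite enormZ ger0_norm// divfK.
Qed.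

Lemma gauge_le K x (t : R) : 0 < t -> K (t^-1 *: x) -> gauge K x <= t.
Proof.
move=> t0 Kx; apply: ge_inf; first exact: gset_lb.
by split; [exact: ltW|exists (t^-1 *: x) => //;
  rewrite scalerA mulfV ?gt_eqF// scale1r].
Qed.

Lemma gauge_ge K x (t : R) : star_body K -> 0 < t -> ~ K (t^-1 *: x) ->
  t <= gauge K x.
Proof.
move=> sK t0 Kx; rewrite leNgt; apply/negP => gt.
have [a [a0 [y Ky yx]] at_] := inf_lt (gset_ne x sK) gt.
apply: Kx; rewrite -yx scalerA; apply: (star_body_shape sK Ky).
by rewrite mulr_ge0 ?invr_ge0 ?(ltW t0)//= mulrC ler_pdivrMr// mul1r ltW.
Qed.

Lemma gauge_ge_enorm K x (C : R) : star_body K -> 0 < C ->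
  (forall x, K x -> enorm x <= C) -> enorm x / C <= gauge K x.
Proof.
move=> sK C0 KC; apply: lb_le_inf; first exact: gset_ne.
move=> a [a0 [y Ky <-]]; rewrite enormZ ger0_norm// ler_pdivrMr// ler_wpM2l//;
  exact: KC.
Qed.

Lemma gauge_le_enorm K x (r : R) : 0 < r -> (forall x, enorm x <= r -> K x) ->
  0 < enorm x -> gauge K x <= enorm x / r.
Proof.
move=> r0 rK x0; apply: gauge_le; first by rewrite divr_gt0.
have e0 : 0 <= r / enorm x by rewrite divr_ge0 ?enorm_ge0// ltW.
by apply: rK; rewrite invf_div enormZ ger0_norm// divfK ?gt_eqF.
Qed.

Lemma gaugeZ K x (t : R) : star_body K -> 0 < t ->
  gauge K (t *: x) = t * gauge K x.
Proof.
move=> sK.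
have le s y : 0 < s -> gauge K (s *: y) <= s * gauge K y.
  move=> s0; rewrite -ler_pdivrMl//; apply: lb_le_inf; first exact: gset_ne.
  move=> a [a0 [z Kz zy]]; rewrite ler_pdivrMl//; apply: ge_inf;
    first exact: gset_lb.
  by split; [rewrite mulr_ge0// ltW|exists z => //; rewrite -zy scalerA].
move=> t0; apply/eqP; rewrite eq_le le//=.
have := le (t^-1) (t *: x);
  rewrite invr_gt0 t0 scalerA mulVf ?gt_eqF// scale1r => /(_ isT).
by rewrite ler_pdivlMl.
Qed.

End star_body.

Lemma le_integral_off_hyperplane (R : realType) n (a : 'rV[R]_n.+1)
  (f g : 'rV[R]_n.+1 -> \bar R) :
  a ord0 ord0 != 0 ->
  measurable_fun setT f -> measurable_fun setT g -> (forall x, 0 <= f x)%E ->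
    (forall x, 0 <= g x)%E ->
  (forall x, dot a x != 0%R -> f x <= g x)%E ->
  (\int[leb (n:=n.+1)]_x f x <= \int[leb (n:=n.+1)]_x g x)%E.
Proof.
move=> a0 mf mg f0 g0 fg.
have mh : measurable_fun setT (f \max g)%E by exact: measurable_maxe.
have h0 x : (0 <= Order.max (f x) (g x))%E by rewrite le_max f0.
rewrite [leRHS](@integral_eq_off_hyperplane _ _ a g (f \max g)%E)//; last first.
  by move=> x /fg fgx; apply/esym/max_idPr.
by apply: ge0_le_integral => // x _; rewrite le_max lexx.
Qed.

(** * Integrals of the radial function *)

Section radial.
Context (R : realType) (n : nat).
Variables (K : set 'rV[R]_n) (sK : star_body K).
Local Notation rho := (radial K).

Lemma gauge_gt0 x : x != 0 -> 0 < minkowski_functional K x.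
Proof.
move=> x0; have [C C0 KC] := star_body_bounded sK.
by apply: lt_le_trans (gauge_ge_enorm x sK C0 KC); rewrite divr_gt0// enorm_gt0.
Qed.

Lemma radial0 : rho 0 = 0.
Proof.
rewrite /radial; have [r r0 rK] := star_body_ball sK.
have : minkowski_functional K 0 <= 0.
  apply: ge_inf; first by exists 0 => a [].
  by split => //; exists 0; [apply: rK; rewrite enorm0 ltW|rewrite scaler0].
have [C C0 KC] := star_body_bounded sK.
have := gauge_ge_enorm 0 sK C0 KC; rewrite enorm0 mul0r => h1 h2.
by rewrite (_ : minkowski_functional K 0 = 0) ?invr0//; apply/eqP;
  rewrite eq_le h1 h2.
Qed.

Lemma radial_ge0 x : 0 <= rho x.
Proof.
have [->|x0] := eqVneq x 0; first by rewrite radial0.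
by rewrite invr_ge0 ltW// gauge_gt0.
Qed.

Lemma radialZ x (t : R) : 0 < t -> rho (t *: x) = t^-1 * rho x.
Proof. by move=> t0; rewrite /radial gaugeZ// invfM. Qed.

Lemma radial_ge x (t : R) : 0 < t -> x != 0 -> K (t^-1 *: x) -> t^-1 <= rho x.
Proof.
by move=> t0 x0 Kx; rewrite lef_pV2 ?posrE ?gauge_gt0//;
  exact: gauge_le.
Qed.

Lemma radial_le x (t : R) : 0 < t -> ~ K (t^-1 *: x) -> rho x <= t^-1.
Proof.
move=> t0 Kx; have gx := gauge_ge sK t0 Kx.
by rewrite lef_pV2 ?posrE// (lt_le_trans t0).
Qed.

Lemma measurable_radial : measurable_fun setT (rho : _ -> R).
Proof.
apply: (measurableT_comp (@measurable_inv R)); apply: continuous_measurable_rV.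
by case: sK.
Qed.

Lemma measurable_star : measurable K.
Proof. by apply: closed_measurable_rV; case: sK. Qed.

Lemma leb_star : (0 < leb K < +oo)%E.
Proof.
have mK := measurable_star.
have [r r0 rK] := star_body_ball sK; have [C C0 KC] := star_body_bounded sK.
apply/andP; split.
  apply: (@lt_le_trans _ _ (leb (@box R n (r / n.+1%:R)))).
    by rewrite leb_box ?divr_ge0 ?(ltW r0)// lte_fin exprn_gt0// mulr_gt0//
      divr_gt0.
  apply: le_measure; rewrite ?inE//; first exact: measurable_box.
  move=> x xr; apply: rK; apply: le_trans (enorm_le_coord _ xr) _;
    first by rewrite divr_ge0// ltW.
  by rewrite mulrCA ler_piMr ?(ltW r0)// ler_pdivrMr// mul1r ler_nat.
apply: (@le_lt_trans _ _ (leb (@box R n C)));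
  last by rewrite leb_box ?ltry// ltW.
apply: le_measure; rewrite ?inE//; first exact: measurable_box.
by move=> x /KC xC i; apply: le_trans (coord_le_enorm _ _) xC.
Qed.

Lemma leb_star_fin_num : leb K \is a fin_num.
Proof. by have /andP[k0 koo] := leb_star; rewrite ge0_fin_numE// ltW. Qed.

Definition scaleset (t : R) : set 'rV[R]_n := [set x | K (t^-1 *: x)].

Lemma measurable_scaleset t : measurable (scaleset t).
Proof.
have m : measurable_fun setT (fun x : 'rV[R]_n => t^-1 *: x).
  by apply: measurable_scalerV => //; exact: measurable_cst.
by have := m measurableT K measurable_star; rewrite setTI.
Qed.

Definition radial_int (A : set 'rV[R]_n) : \bar R :=
  (\int[leb (n:=n)]_x ((\1_A x)%:E * (rho x)%:E))%E.

Lemma measurable_radial_integrand A : measurable A ->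
  measurable_fun setT (fun x => (\1_A x)%:E * (rho x)%:E)%E.
Proof.
move=> mA; apply: emeasurable_funM; first exact: measurable_EFin_indic.
by apply/measurable_EFinP; exact: measurable_radial.
Qed.

Lemma radial_integrand_ge0 A x : (0 <= (\1_A x)%:E * (rho x)%:E)%E.
Proof. by rewrite mule_ge0// lee_fin radial_ge0. Qed.

Lemma radial_int_ge0 A : (0 <= radial_int A)%E.
Proof. by apply: integral_ge0 => x _; exact: radial_integrand_ge0. Qed.

Lemma indic_scaleset t x : 0 < t -> \1_(scaleset t) (t *: x) = \1_K x :> R.
Proof.
move=> t0; rewrite !indicE; congr (nat_of_bool _)%:R.
by apply/idP/idP => /set_mem; rewrite /scaleset/= => h; apply/mem_set; move: h;
  rewrite /= scalerA mulVf ?gt_eqF// scale1r.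
Qed.

Lemma leb_scaleset t : 0 < t -> leb (scaleset t) = ((t ^+ n)%:E * leb K)%E.
Proof.
move=> t0; rewrite !leb_indic//;
  [|exact: measurable_star|exact: measurable_scaleset].
rewrite (integral_scale t0)//; last by apply: measurable_EFin_indic;
  exact: measurable_scaleset.
by under eq_integral do rewrite indic_scaleset//.
Qed.

Lemma radial_int_scaleset t : (0 < n)%N -> 0 < t ->
  radial_int (scaleset t) = ((t ^+ n.-1)%:E * radial_int K)%E.
Proof.
move=> n0 t0; rewrite /radial_int (integral_scale t0)//; last 2 first.
- by apply: measurable_radial_integrand; exact: measurable_scaleset.
- exact: radial_integrand_ge0.
transitivity ((t ^+ n)%:E * \int[leb (n:=n)]_x
  ((t^-1)%:E * ((\1_K x)%:E * (rho x)%:E)))%E.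
  congr (_ * _)%E; apply: eq_integral => x _.
  by rewrite indic_scaleset// radialZ// EFinM muleCA.
rewrite ge0_integralZl//; last 3 first.
- by apply: measurable_radial_integrand; exact: measurable_star.
- by move=> x _; exact: radial_integrand_ge0.
- by rewrite lee_fin invr_ge0 ltW.
by rewrite muleA -EFinM -{1}(prednK n0) exprSr mulfK// gt_eqF.
Qed.

(** As rho >= 1/t on the dilate and rho <= 1/t outside, the inequality
    rho 1_A + 1/t 1_(tK) <= rho 1_(tK) + 1/t 1_A holds pointwise; the terms in
    1/t have the same integral. At the origin, where the quotient defining rho
    has the value 0, both indicators are 1. *)
Lemma radial_int_bathtub (A : set 'rV[R]_n) (t : R) : 0 < t -> measurable A ->
  A 0 -> leb A = leb (scaleset t) ->
  (radial_int A <= radial_int (scaleset t))%E.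
Proof.
move=> t0 mA A0 At.
have mtK := measurable_scaleset t.
have fin : ((t^-1)%:E * leb A)%E \is a fin_num.
  rewrite At leb_scaleset//; have /andP[k0 koo] := leb_star.
  by rewrite fin_numM// fin_numM// ge0_fin_numE// ltW.
have split B C : measurable B -> measurable C ->
  (radial_int B + (t^-1)%:E * leb C =
   \int[leb (n:=n)]_x ((\1_B x)%:E * (rho x)%:E + (t^-1)%:E * (\1_C x)%:E))%E.
  move=> mB mC; rewrite ge0_integralD//.
  - by rewrite ge0_integralZl// ?leb_indic// ?lee_fin ?invr_ge0 ?(ltW t0)//;
    exact: measurable_EFin_indic.
  - by move=> x _; exact: radial_integrand_ge0.
  - exact: measurable_radial_integrand.
  - by move=> x _; rewrite mule_ge0// lee_fin// invr_ge0 ltW.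
  - by apply: measurable_funeM; exact: measurable_EFin_indic.
rewrite -(leeD2rE _ _ fin) {1}At split// split//.
apply: ge0_le_integral => //.
- by move=> x _; rewrite adde_ge0// ?radial_integrand_ge0// mule_ge0// lee_fin//
  invr_ge0 ltW.
- apply: emeasurable_funD; first exact: measurable_radial_integrand.
  by apply: measurable_funeM; exact: measurable_EFin_indic.
- apply: emeasurable_funD; first exact: measurable_radial_integrand.
  by apply: measurable_funeM; exact: measurable_EFin_indic.
move=> x _; rewrite -!EFinM -!EFinD lee_fin !indicE.
have [xA|xA] := boolP (x \in A); have [xK|xK] := boolP (x \in scaleset t) => /=.
- by [].
- rewrite !(mulr1n, mulr0n, mul1r, mul0r, mulr0, mulr1, add0r, addr0).
  apply: radial_le => // h.
  by move/negP: xK; apply; exact/mem_set.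
- rewrite !(mulr1n, mulr0n, mul1r, mul0r, mulr0, mulr1, add0r, addr0);
  apply: radial_ge => //; last exact: set_mem.
  by apply: contra xA => /eqP ->; exact/mem_set.
- by rewrite !(mul0r, mulr0).
Qed.

End radial.

Section approximation.
Context (R : realType) (n : nat).

Lemma sphere_bounds (M : set 'rV[R]_n) : star_body M ->
  exists c C : R, 0 < c /\ forall xi, enorm xi = 1 -> c <= radial M xi <= C.
Proof.
move=> sM; have [r r0 rM] := star_body_ball sM; have [C C0 MC] :=
  star_body_bounded sM.
exists r, C; split => // xi xi1.
have x0 : xi != 0 by apply/eqP => x0; move: xi1; rewrite x0 enorm0 => /esym/eqP;
  rewrite oner_eq0.
have g0 := gauge_gt0 sM x0.
have h1 := gauge_le_enorm r0 rM (enorm_gt0 x0).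
have h2 := gauge_ge_enorm xi sM C0 MC.
rewrite /radial -[r]invrK -[C]invrK !lef_pV2 ?posrE ?invr_gt0//.
by move: h1 h2; rewrite xi1 !mul1r => -> ->.
Qed.

(** On the sphere rho_K is bounded away from 0, so that a small radial distance
    is a small relative error. The bounds of [sphere_bounds] also make
    [radial_dist] an upper bound of the pointwise distances: the supremum of an
    unbounded set would be 0. *)
Lemma radial_approx (K : set 'rV[R]_n) (d : R) : star_body K ->
  intersection_body K -> 0 < d -> exists M D : set 'rV[R]_n,
  [/\ star_body D, is_intersection_body_of M D &
      forall xi, enorm xi = 1 ->
        `|radial K xi - radial M xi| <= d * radial K xi].
Proof.
move=> sK [_ h] d0; have [c [C [c0 cK]]] := sphere_bounds sK.
have [M [D [[sM _] [sD _] MD KM]]] := h _ (mulr_gt0 d0 c0).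
exists M, D; split => // xi xi1.
have /andP[cx xC] := cK _ xi1.
apply: (@le_trans _ _ (d * c)); last by rewrite ler_wpM2l// ltW.
apply: le_trans (ltW KM); apply: ub_le_sup; last by exists xi.
have [c' [C' [c'0 cM]]] := sphere_bounds sM.
exists (C + C') => _ [y y1 <-]; have /andP[? ?] := cK _ y1; have /andP[? ?] :=
  cM _ y1.
by apply: le_trans (ler_normB _ _) _; rewrite !ger0_norm ?lerD// ?radial_ge0.
Qed.

End approximation.

Section radial_int_bounds.
Context (R : realType) (n : nat).
Variables (K : set 'rV[R]_n.+1) (sK : star_body K).
Local Notation rho := (radial K).

Lemma radial_int_gt0 : (0 < radial_int K K)%E.
Proof.
have /andP[k0 _] := leb_star sK; have mK := measurable_star sK.
apply: lt_le_trans k0 _; rewrite leb_indic//.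
apply: (@le_integral_off_hyperplane _ _ (basis0 R n)) => //.
- exact: basis0_neq0.
- exact: measurable_EFin_indic.
- exact: measurable_radial_integrand.
- exact: radial_integrand_ge0.
move=> x; rewrite dot_basis0 => /coord0_neq0 x0.
rewrite indicE; have [xK|xK] := boolP (x \in K); last by rewrite mul0e.
rewrite mul1e lee_fin -[leLHS]invr1; apply: radial_ge => //.
by rewrite invr1 scale1r; exact: set_mem.
Qed.

Let g (N : nat) (x : 'rV[R]_n.+1) : \bar R :=
  ((\1_K x)%:E * (Num.min (rho x) N%:R)%:E)%E.
Let mmin (N : nat) : measurable_fun setT (fun x => (Num.min (rho x) N%:R)%:E).
Proof.
apply/measurable_EFinP; apply: measurable_minr; first exact: measurable_radial.
exact: measurable_cst.
Qed.

Let mg N : measurable_fun setT (g N).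
Proof.
by apply: emeasurable_funM => //; apply: measurable_EFin_indic;
  exact: measurable_star.
Qed.

Let min0 N x : 0 <= Num.min (rho x) N%:R.
Proof. by rewrite le_min radial_ge0//=. Qed.

Let g0 N x : (0 <= g N x)%E.
Proof. by rewrite mule_ge0// lee_fin. Qed.

(** Truncate rho at N and let I be its integral over K, in dimension n + 1. By
    homogeneity the part of I on K / 2 is at most 2^-n I <= I / 2, and
    rho <= 2 on the rest. Hence I <= I / 2 + 2 |K|, which bounds I by 4 |K|
    whatever N is. *)
Lemma radial_int_lty : (0 < n)%N -> (radial_int K K < +oo)%E.
Proof.
move=> n0.
have /andP[k0 koo] := leb_star sK; have mK := measurable_star sK.
have bound N : (\int[leb (n:=n.+1)]_x g N x <= 4%:E * leb K)%E.
  set I := (X in (X <= _)%E).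
  have Ifin : I \is a fin_num.
    rewrite ge0_fin_numE; last by apply: integral_ge0 => x _; exact: g0.
    apply: (@le_lt_trans _ _ (N%:R%:E * leb K)%E);
      last by rewrite lte_mul_pinfty.
    rewrite leb_indic// -ge0_integralZl//; last exact: measurable_EFin_indic.
    apply: ge0_le_integral => //.
    - by apply: measurable_funeM; exact: measurable_EFin_indic.
    - by move=> x _; rewrite /g muleC -!EFinM lee_fin ler_wpM2r// ge_min lexx
      orbT.
  pose H := scaleset K 2^-1.
  have mH : measurable H by exact: measurable_scaleset.
  pose h (x : 'rV[R]_n.+1) : \bar R :=
    ((\1_H x)%:E * (Num.min (rho x) N%:R)%:E)%E.
  have mh : measurable_fun setT h.
    by apply: emeasurable_funM => //; exact: measurable_EFin_indic.
  have h0 x : (0 <= h x)%E by rewrite mule_ge0// lee_fin.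
  have mhalf : measurable_fun setT (fun x : 'rV[R]_n.+1 => 2^-1 *: x).
    by apply: measurable_scalerV => //; exact: measurable_cst.
  have half : (\int[leb (n:=n.+1)]_x h x <= (2^-1)%:E * I)%E.
    rewrite (@integral_scale _ _ 2^-1)//.
    apply: (@le_trans _ _ ((2^-1 ^+ n.+1)%:E * \int[leb (n:=n.+1)]_x
      (2%:E * g N x))%E).
      apply: lee_wpmul2l; first by rewrite lee_fin.
      apply: ge0_le_integral => //.
      - exact: (measurableT_comp mh mhalf).
      - exact: measurable_funeM.
      move=> x _; rewrite /h indic_scaleset// radialZ// invrK /g muleCA.
      apply: lee_wpmul2l; first by rewrite lee_fin.
      by rewrite -EFinM lee_fin minr_pMr// le_min !ge_min lexx/= ler_peMl
        ?orbT// ler1n.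
    rewrite ge0_integralZl// muleA -EFinM; apply: lee_wpmul2r;
      first by apply: integral_ge0.
    rewrite lee_fin exprSr -mulrA mulVf// mulr1.
    by rewrite -[leRHS]expr1 ler_wiXn2l ?invr_ge0 ?invf_le1 ?ler1n.
  have : (I <= (2^-1)%:E * I + 2%:E * leb K)%E.
    apply: le_trans (leeD2r _ half).
    rewrite leb_indic// -ge0_integralZl//; last exact: measurable_EFin_indic.
    rewrite -ge0_integralD//; last by apply: measurable_funeM;
      exact: measurable_EFin_indic.
    apply: ge0_le_integral => //.
    - by apply: emeasurable_funD => //; apply: measurable_funeM;
      exact: measurable_EFin_indic.
    move=> x _; rewrite /g /h -!EFinM -EFinD lee_fin !indicE.
    have [xK|xK] := boolP (x \in K); last by rewrite mul0r addr_ge0// mulr_ge0.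
    have [xH|xH] := boolP (x \in H); first by rewrite !mulr1n lerDl mulr_ge0.
    rewrite !mulr1n !mul1r mulr0n mul0r add0r mulr1 ge_min.
    rewrite -[X in _ <= X]invrK (radial_le sK)// => h'.
    by move/negP: xH; apply; exact/mem_set.
  have kE : leb K = (fine (leb K))%:E by rewrite fineK// ge0_fin_numE// ltW.
  by rewrite -(fineK Ifin) kE -!EFinM -EFinD !lee_fin => hr; lra.
have -> : radial_int K K = (limn (fun N => \int[leb (n:=n.+1)]_x g N x))%E.
  rewrite -monotone_convergence//; last first.
    move=> x _ a b ab; apply: lee_wpmul2l; first by rewrite lee_fin.
    by rewrite lee_fin le_min ge_min lexx/= ge_min ler_nat ab orbT.
  apply: eq_integral => x _; apply/esym/cvg_lim => //.
  apply: cvg_near_cst; near=> N; rewrite /g; congr (_ * _%:E)%E.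
  apply/min_idPl; near: N; exact: nbhs_infty_ger.
apply: (@le_lt_trans _ _ (4%:E * leb K)%E); last by rewrite lte_mul_pinfty.
apply: lime_le; last by apply: nearW.
apply: ereal_nondecreasing_is_cvgn => a b ab; apply: ge0_le_integral => //.
- move=> x _; apply: lee_wpmul2l; first by rewrite lee_fin.
  by rewrite lee_fin le_min ge_min lexx/= ge_min ler_nat ab orbT.
Unshelve. all: by end_near. Qed.

(** Compare A with the dilate of K of the same volume; for A equal to that
    dilate there is equality. *)
Lemma radial_int_le_pow (A : set 'rV[R]_n.+1) : measurable A -> A 0 ->
  (0 < leb A < +oo)%E ->
  ((fine (leb K) `^ (n%:R / n.+1%:R))%:E * radial_int K A <=
    (fine (leb A) `^ (n%:R / n.+1%:R))%:E * radial_int K K)%E.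
Proof.
move=> mA A0 Ap.
have root (X : \bar R) : (0 < X < +oo)%E -> exists2 u : R, 0 < u &
    X = (u ^+ n.+1)%:E /\ fine X `^ (n%:R / n.+1%:R) = u ^+ n.
  case: X => [b /andP[]|/andP[]|/andP[]]//; rewrite lte_fin => b0 _.
  exists (b `^ n.+1%:R^-1); first exact: powR_gt0.
  rewrite -!powR_mulrn ?powR_ge0// -!powRrM mulVf ?pnatr_eq0//
    powRr1 ?(ltW b0)//.
  by rewrite [fine _]/= mulrC.
have [v v0 [KE ->]] := root _ (leb_star sK).
have [u u0 [AE ->]] := root _ Ap.
have t0 : 0 < u / v by rewrite divr_gt0.
have v0' : v != 0 by rewrite gt_eqF.
(* u^(n+1) = |A| and v^(n+1) = |K|, so that the factor is u / v. *)
have Et : leb A = leb (scaleset K (u / v)).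
  by rewrite leb_scaleset// KE AE -EFinM expr_div_n divfK// expf_neq0.
have := radial_int_bathtub sK t0 mA A0 Et.
rewrite radial_int_scaleset// expr_div_n [n.+1.-1]/= => h.
apply: le_trans (lee_wpmul2l _ h) _; first by rewrite lee_fin exprn_ge0// ltW.
by rewrite muleA -EFinM mulrCA mulfV ?mulr1// expf_neq0.
Qed.

End radial_int_bounds.

(** * Central sections *)

Section slices.
Context (R : realType) (n : nat).
Local Notation ind A := (fun z : 'rV[R]_n.+1 => (\1_A z : R)%:E).

Lemma frameP (xi : 'rV[R]_n.+1) : enorm xi = 1 -> is_frame xi (frame xi).
Proof. by move=> xi1; rewrite /frame; apply: xgetPex; exact: is_frame_ex. Qed.

Lemma hvolE (xi : 'rV[R]_n.+1) (A : set 'rV[R]_n.+1) : enorm xi = 1 ->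
  hvol xi (A `&` hyperplane xi) = leb [set z : 'rV[R]_n | A (z *m frame xi)].
Proof.
move=> /frameP xi1; rewrite /hvol -lebE; congr (leb _).
by apply/seteqP; split => z /= => [[]//|Az]; split => //;
  exact: frame_hyperplane.
Qed.

Lemma hvol_radon (xi : 'rV[R]_n.+1) (A : set 'rV[R]_n.+1) : enorm xi = 1 ->
  xi ord0 ord0 != 0 -> measurable A ->
  hvol xi (A `&` hyperplane xi) = radon (ind A) xi.
Proof.
move=> xi1 xi0 mA; rewrite hvolE// -(integral_frame _ _ xi1 xi0 (frameP xi1))//;
  last exact: measurable_EFin_indic.
have mU : measurable_fun setT (fun z : 'rV[R]_n => z *m frame xi).
  exact: (measurable_mulmxr _ (@measurable_id _ _ _)).
by rewrite leb_indic//; have := mU measurableT A mA; rewrite setTI.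
Qed.

Lemma radonZ (f : 'rV[R]_n.+1 -> \bar R) x (c : R) : 0 < c ->
  radon f (c *: x) = ((c^-1)%:E * radon f x)%E.
Proof.
move=> c0; rewrite /radon mxE normrM gtr0_norm// invfM EFinM -muleA;
  congr (_ * (_ * _))%E.
apply: eq_integral => y _; congr (f (rowcons _ _)); rewrite mxE.
have -> : dot (rowtail (c *: x)) y = c * dot (rowtail x) y.
  by rewrite /dot mulr_sumr; apply: eq_bigr => i _; rewrite !mxE mulrA.
by rewrite -mulrN -mulf_div mulfV ?mul1r// gt_eqF.
Qed.

Lemma radon_hvol (x : 'rV[R]_n.+1) (A : set 'rV[R]_n.+1)
  (xi := (enorm x)^-1 *: x) : x ord0 ord0 != 0 -> measurable A ->
  radon (ind A) x = (((enorm x)^-1)%:E * hvol xi (A `&` hyperplane xi))%E.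
Proof.
move=> x0 mA; have ex := enorm_gt0 (coord0_neq0 x0).
rewrite hvol_radon//; last 2 first.
- exact/enorm_normalize/coord0_neq0.
- by rewrite mxE mulf_neq0// invr_neq0// gt_eqF.
by rewrite radonZ ?invr_gt0// invrK muleA -EFinM mulVf ?mul1e// gt_eqF.
Qed.

Lemma hvol_eball (xi : 'rV[R]_n.+1) : enorm xi = 1 ->
  hvol xi (@eball R n.+1 `&` hyperplane xi) = leb (@eball R n).
Proof.
move=> xi1; rewrite hvolE//; congr (leb _).
by have [UU _] := frameP xi1; apply/seteqP; split => z /=;
  rewrite /eball/= enorm_frame.
Qed.

Lemma radon_coord0 (f : 'rV[R]_n.+1 -> \bar R) (x : 'rV[R]_n.+1) :
  x ord0 ord0 = 0 -> radon f x = 0%E.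
Proof. by move=> x0; rewrite /radon x0 normr0 invr0 mul0e. Qed.

End slices.

Lemma le_poweR_fine (R : realType) (x y : \bar R) (p c : R) :
  x \is a fin_num -> y \is a fin_num ->
  fine x `^ p <= fine y `^ p + c -> (x `^ p <= y `^ p + c%:E)%E.
Proof. by case: x => // x _; case: y. Qed.

Lemma le_of_near1 (R : realFieldType) (k X : R) : 0 < k -> 0 <= X ->
  (forall d, 0 < d -> d <= 1 -> (1 - d) * k <= (1 + d) * X) -> k <= X.
Proof.
move=> k0 X0 h; rewrite leNgt; apply/negP => Xk.
have kX : 0 < k + X by rewrite ltr_pwDl.
(* With this value of d, the term d * (k + X) is half of the gap k - X. *)
have dE : (k - X) / (2 * (k + X)) * (k + X) = (k - X) / 2 by field;
  rewrite gt_eqF.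
have d0 : 0 < (k - X) / (2 * (k + X)) by rewrite divr_gt0 ?subr_gt0// mulr_gt0.
have d1 : (k - X) / (2 * (k + X)) <= 1 by rewrite ler_pdivrMr ?mulr_gt0// mul1r;
  lra.
by have := h _ d0 d1; move: (_ / _) dE {d0 d1 h} => d dE; nra.
Qed.

(** * The stability inequality *)

Section stability.
Context (R : realType) (m : nat).
Local Notation n := m.+2.
Local Notation ind A := (fun z : 'rV[R]_n => (\1_A z : R)%:E).
Variables (eps : R) (K L : set 'rV[R]_n).
Hypothesis eps0 : 0 < eps.
Hypothesis sK : star_body K.
Hypothesis sL : star_body L.
Hypothesis KL : forall xi : 'rV[R]_n, esphere xi ->
    (hvol xi (K `&` hyperplane xi) <= hvol xi (L `&` hyperplane xi) + eps%:E)%E.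

Let beta := fine (leb (@eball R m.+1)).
Let betaE : leb (@eball R m.+1) = beta%:E.
Proof.
by have /andP[b0 boo] := leb_eball R m.+1;
  rewrite /beta fineK// ge0_fin_numE// ltW.
Qed.

Let beta0 : 0 < beta.
Proof. by have /andP[b0 boo] := leb_eball R m.+1; rewrite fine_gt0// b0. Qed.

Let radon_pair (A D : set 'rV[R]_n) :=
  (\int[leb (n:=n)]_x (ind A x * radon (ind D) x))%E.
Let measurable_ind A : measurable A -> measurable_fun setT (ind A).
Proof. exact: measurable_EFin_indic. Qed.

Let ind_ge0 A x : (0 <= ind A x)%E. Proof. by rewrite lee_fin. Qed.
Let measurable_radon_ind A : measurable A ->
  measurable_fun setT (radon (ind A)).
Proof. by move=> mA; apply: measurable_radon => //; exact: measurable_ind. Qed.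

Let measurable_radon_pair A D : measurable A -> measurable D ->
  measurable_fun setT (fun x => ind A x * radon (ind D) x)%E.
Proof.
by move=> mA mD; apply: emeasurable_funM;
  [exact: measurable_ind|exact: measurable_radon_ind].
Qed.

Let radon_pair_ge0 A D x : (0 <= ind A x * radon (ind D) x)%E.
Proof. by rewrite mule_ge0// radon_ge0. Qed.

Let radon_pair_symm A D : measurable A -> measurable D ->
  radon_pair A D = radon_pair D A.
Proof.
by move=> mA mD; rewrite /radon_pair radon_symm//;
  exact: measurable_ind.
Qed.

(** By symmetry all integrals are taken over D, where the hypothesis on the
    sections applies pointwise. The sections of the ball all have volume beta,
    which turns eps into a multiple of the section function of the ball. *)
Lemma radon_compare D : measurable D ->
  (radon_pair K D <= radon_pair L D + (eps / beta)%:E * radon_pair (@eball R n)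
    D)%E.
Proof.
move=> mD; have mK := measurable_star sK; have mL := measurable_star sL.
have mB := @measurable_eball R n.
have e0' : 0 <= eps / beta by rewrite divr_ge0 ?(ltW eps0) ?(ltW beta0).
rewrite !(radon_pair_symm _ mD)// /radon_pair -ge0_integralZl//;
  last exact: measurable_radon_pair.
rewrite -ge0_integralD//; last 3 first.
- exact: measurable_radon_pair.
- by move=> x _; rewrite mule_ge0.
- by apply: measurable_funeM; exact: measurable_radon_pair.
apply: ge0_le_integral => //.
- exact: measurable_radon_pair.
- by apply: emeasurable_funD;
  [exact: measurable_radon_pair|apply: measurable_funeM;
  exact: measurable_radon_pair].
move=> x _; rewrite [X in (_ + X)%E]muleCA -ge0_muleDr; last 2 first.
- exact: radon_ge0.
- by apply: mule_ge0; [rewrite lee_fin|exact: radon_ge0].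
apply: lee_wpmul2l => //.
have [x0|x0] := eqVneq (x ord0 ord0) 0;
  first by rewrite !radon_coord0// mule0 adde0.
have xn0 := coord0_neq0 x0.
rewrite !radon_hvol// hvol_eball ?enorm_normalize// betaE.
have -> : ((eps / beta)%:E * (((enorm x)^-1)%:E * beta%:E) =
  ((enorm x)^-1)%:E * eps%:E)%E.
  by rewrite -!EFinM; congr (_%:E); field; rewrite !gt_eqF// enorm_gt0.
rewrite -ge0_muleDr//; last by rewrite lee_fin ltW.
by apply: lee_wpmul2l; [rewrite lee_fin invr_ge0 enorm_ge0|apply: KL;
  exact: enorm_normalize].
Qed.

Lemma radon_approx (d : R) (M D : set 'rV[R]_n) (x : 'rV[R]_n) : star_body D ->
  is_intersection_body_of M D ->
  (forall xi, enorm xi = 1 ->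
    `|radial K xi - radial M xi| <= d * radial K xi) ->
  x ord0 ord0 != 0 ->
  (((1 - d) * radial K x)%:E <= radon (ind D) x <= ((1 + d) * radial K x)%:E)%E.
Proof.
move=> sD MD KM x0; have xn0 := coord0_neq0 x0; have ex := enorm_gt0 xn0.
have xi1 := enorm_normalize xn0; set xi := (enorm x)^-1 *: x in xi1.
rewrite radon_hvol//; last exact: measurable_star.
rewrite -/xi -MD// -EFinM !lee_fin.
have -> : radial K x = (enorm x)^-1 * radial K xi.
  by rewrite -radialZ// /xi scalerA mulfV ?scale1r// gt_eqF.
rewrite !(mulrCA _ (enorm x)^-1) !ler_pM2l ?invr_gt0//.
have := KM _ xi1; rewrite ler_norml => /andP[h1 h2]; apply/andP; split; lra.
Qed.

Lemma radial_int_compare (d : R) : intersection_body K -> 0 < d -> d <= 1 ->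
  ((1 - d)%:E * radial_int K K <=
    (1 + d)%:E * (radial_int K L + (eps / beta)%:E * radial_int K
    (@eball R n)))%E.
Proof.
move=> iK d0 d1; have [M [D [sD MD KM]]] := radial_approx sK iK d0.
have mD := measurable_star sD; have mK := measurable_star sK;
  have mL := measurable_star sL.
have mB := @measurable_eball R n.
have e0' : 0 <= eps / beta by rewrite divr_ge0 ?(ltW eps0) ?(ltW beta0).
have d1' : 0 <= 1 - d by rewrite subr_ge0.
have d2' : 0 <= 1 + d by rewrite addr_ge0// ltW.
have lower : ((1 - d)%:E * radial_int K K <= radon_pair K D)%E.
  rewrite /radial_int -ge0_integralZl//; last 2 first.
  - exact: measurable_radial_integrand.
  - by move=> x _; exact: radial_integrand_ge0.
  apply: (@le_integral_off_hyperplane _ _ (basis0 R m.+1)) => //.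
  - exact: basis0_neq0.
  - by apply: measurable_funeM; exact: measurable_radial_integrand.
  - exact: measurable_radon_pair.
  - by move=> x; rewrite mule_ge0 ?radial_integrand_ge0.
  move=> x; rewrite dot_basis0 => x0; rewrite [leLHS]muleCA;
    apply: lee_wpmul2l => //.
  by have /andP[h _] := radon_approx sD MD KM x0; rewrite -EFinM.
have upper A : measurable A ->
  (radon_pair A D <= (1 + d)%:E * radial_int K A)%E.
  move=> mA; rewrite /radial_int -ge0_integralZl//; last 2 first.
  - exact: measurable_radial_integrand.
  - by move=> x _; exact: radial_integrand_ge0.
  apply: ge0_le_integral => //.
  - exact: measurable_radon_pair.
  - by apply: measurable_funeM; exact: measurable_radial_integrand.
  move=> x _; rewrite [leRHS]muleCA; apply: lee_wpmul2l => //.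
  have [x0|x0] := eqVneq (x ord0 ord0) 0.
    by rewrite radon_coord0// -EFinM lee_fin mulr_ge0 ?radial_ge0.
  by have /andP[_ h] := radon_approx sD MD KM x0; rewrite -EFinM.
apply: le_trans lower _; apply: le_trans (radon_compare mD) _.
rewrite [leRHS]ge0_muleDr ?mule_ge0 ?radial_int_ge0//.
apply: leeD; first exact: upper.
by rewrite muleCA; apply: lee_wpmul2l => //; exact: upper.
Qed.

(** All the terms of [radial_int_compare] become multiples of int_K rho_K, a
    positive real number. *)
Lemma compare_weights (k l b : R) : intersection_body K ->
  0 < k -> 0 <= l -> 0 <= b ->
  (k%:E * radial_int K L <= l%:E * radial_int K K)%E ->
  (k%:E * radial_int K (@eball R n) <= b%:E * radial_int K K)%E ->
  k <= l + b / beta * eps.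
Proof.
move=> iK k0 l0 b0.
have j0 := radial_int_gt0 sK; have joo := radial_int_lty sK (ltn0Sn m).
have jE : radial_int K K = (fine (radial_int K K))%:E.
  by rewrite fineK// ge0_fin_numE// ltW.
have {j0 joo} : 0 < fine (radial_int K K) by rewrite fine_gt0// j0.
move: (fine (radial_int K K)) jE => j jE j0 hL hB; apply: le_of_near1 => //.
  by rewrite addr_ge0// mulr_ge0 ?divr_ge0// ltW.
move=> d d0 d1; have d2 : 0 <= 1 + d by rewrite addr_ge0// ltW.
have e0' : 0 <= eps / beta by rewrite divr_ge0 ?(ltW eps0) ?(ltW beta0).
have h : (k%:E * ((1 - d)%:E * radial_int K K) <= (1 + d)%:E *
    (l%:E * radial_int K K + (eps / beta)%:E * (b%:E * radial_int K K)))%E.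
  apply: le_trans (lee_wpmul2l _ (radial_int_compare iK d0 d1)) _.
    by rewrite lee_fin ltW.
  rewrite muleCA; apply: lee_wpmul2l => //.
  rewrite ge0_muleDr ?mule_ge0 ?radial_int_ge0//; apply: leeD => //.
  by rewrite muleCA; apply: lee_wpmul2l.
move: h; rewrite jE -!EFinM lee_fin => h.
rewrite -(ler_pM2r j0); have -> : (1 - d) * k * j = k * ((1 - d) * j) by ring.
apply: le_trans h _; rewrite le_eqVlt; apply/orP; left; apply/eqP; field.
by rewrite gt_eqF.
Qed.

Lemma stability_ge2 : intersection_body K ->
  fine (leb K) `^ (m.+1%:R / m.+2%:R) <=
  fine (leb L) `^ (m.+1%:R / m.+2%:R) +
  fine (leb (@eball R n)) `^ (m.+1%:R / m.+2%:R) / beta * eps.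
Proof.
move=> iK; apply: (compare_weights iK).
- by apply: powR_gt0; have /andP[? ?] := leb_star sK; apply: fine_gt0;
  apply/andP.
- exact: powR_ge0.
- exact: powR_ge0.
- apply: (radial_int_le_pow sK); [exact: measurable_star| |exact: leb_star].
  by have [r r0] := star_body_ball sL; apply; rewrite enorm0 ltW.
- apply: (radial_int_le_pow sK); [exact: measurable_eball| |exact: leb_eball].
  by rewrite /eball/= enorm0.
Qed.

End stability.

Theorem theorem1 (R : realType) (n : nat) (eps : R) (K L : set 'rV[R]_n) :
  (0 < n)%N ->
  0 < eps ->
  sym_star_body K -> sym_star_body L ->
  intersection_body K ->
  (forall xi : 'rV[R]_n, esphere xi ->
    (hvol xi (K `&` hyperplane xi)
       <= hvol xi (L `&` hyperplane xi) + eps%:E)%E) ->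
  (vol K `^ (n.-1%:R / n%:R)
     <= vol L `^ (n.-1%:R / n%:R) + (stab_const R n * eps)%:E)%E.
Proof.
case: n K L => [|[|m]]// K L _ eps0 [sK _] [sL _] iK KL.
  (* In dimension 1 the exponent is 0 and both powers are 1. *)
  rewrite mul0r !poweRe0 leeDl// lee_fin; apply: mulr_ge0; last exact: ltW.
  apply: divr_ge0; first exact: powR_ge0.
  by apply: fine_ge0; rewrite -lebE.
rewrite -!lebE; apply: le_poweR_fine.
- exact: leb_star_fin_num sK.
- exact: leb_star_fin_num sL.
- exact: (stability_ge2 eps0 sK sL KL iK).
Qed.
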